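(* Let $G=(V,E)$ be a graph with nonnegative edge weights, and let $\mathcal{M}=(V,\mathcal{I})$ be a matroid of rank $k$, accessible by oracle. In the incidence streaming model, for every $\varepsilon>0$ one can, in a single pass, extract a set $S\in\mathcal{I}$ with $E_G(S)\ge(1-\varepsilon)\max_{X\in\mathcal{I}}E_G(X)$ using $O\left(\left(\frac{k}{\varepsilon}\right)^2\right)$ variables of memory when $\mathcal{M}$ is a uniform, partition, or laminar matroid, and $O\left(\left(\frac{k}{\varepsilon}+k\right)^2\right)$ variables when $\mathcal{M}$ is a transversal matroid.
   Context: For $S\subseteq V$, $E_G(S)$ is the total weight of edges having at least one endpoint in $S$. In the incidence streaming model, the vertices are presented in an arbitrary order and, for each vertex, all its incident edges (with weights) are given consecutively; thus each edge appears twice in the stream. The matroid is available through an oracle that can be queried freely, and memory is counted in stored variables. A uniform matroid of rank $k$ has as independent sets all sets of size at most $k$. A partition matroid is given by a partition $V_1,\dots,V_r$ of $V$ and bounds $k_i$, with $S$ independent iff $|S\cap V_i|\le k_i$ for all $i$. A laminar matroid is given by a laminar family of subsets $V_i$ of $V$ with bounds $k_i$, with $S$ independent iff $|S\cap V_i|\le k_i$ for all $i$. A transversal matroid is given by a family $V_1,\dots,V_k\subseteq V$, with $S=\{u_1,\dots,u_s\}$ independent iff there are distinct indices $\phi(i)$ with $u_i\in V_{\phi(i)}$. *)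

(* Defs.v *)
From HB Require Import structures.
From mathcomp Require Import all_boot all_order all_algebra.
From mathcomp Require Import reals.

Set Implicit Arguments.
Unset Strict Implicit.
Unset Printing Implicit Defensive.

Import Order.TTheory GRing.Theory Num.Theory.
Local Open Scope ring_scope.

Record wgraph (R : realType) (V : finType) := WGraph {
  edges : {set {set V}};
  weight : {set V} -> R;
  edges_card2 : forall e, e \in edges -> #|e| = 2;
  weight_ge0 : forall e, e \in edges -> 0 <= weight e
}.

Definition cover_weight (R : realType) (V : finType) (G : wgraph R V)
    (S : {set V}) : R :=
  \sum_(e in edges G | e :&: S != set0) weight G e.

Record matroid (V : finType) := Matroid {
  indep : pred {set V};
  indep0 : indep set0;
  indep_sub : forall A B : {set V}, A \subset B -> indep B -> indep A;
  indep_exchange : forall A B : {set V}, indep A -> indep B ->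
    (#|A| < #|B|)%N -> exists2 x, x \in B :\: A & indep (x |: A)
}.

Definition mrank (V : finType) (M : matroid V) : nat :=
  (\max_(A : {set V} | indep M A) #|A|)%N.

Definition uniform_matroid (V : finType) (M : matroid V) : Prop :=
  forall S : {set V}, indep M S = (#|S| <= mrank M)%N.

Definition partition_matroid (V : finType) (M : matroid V) : Prop :=
  exists (P : {set {set V}}) (b : {set V} -> nat),
    partition P [set: V] /\
    forall S : {set V}, indep M S = [forall B in P, (#|S :&: B| <= b B)%N].

Definition laminar_family (V : finType) (F : {set {set V}}) : Prop :=
  forall A B, A \in F -> B \in F ->
    [\/ A \subset B, B \subset A | [disjoint A & B]].

Definition laminar_matroid (V : finType) (M : matroid V) : Prop :=
  exists (F : {set {set V}}) (b : {set V} -> nat),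
    laminar_family F /\
    forall S : {set V}, indep M S = [forall B in F, (#|S :&: B| <= b B)%N].

(* Membership in [nth set0 F (phi u)] forces [phi u < size F].  The number of
   sets in the presentation may exceed the rank. *)
Definition transversal_matroid (V : finType) (M : matroid V) : Prop :=
  exists F : seq {set V},
    forall S : {set V}, indep M S <->
      exists2 phi : V -> nat,
        {in S &, injective phi} &
        forall u, u \in S -> u \in nth set0 F (phi u).

Definition opt (R : realType) (V : finType) (G : wgraph R V)
    (M : matroid V) : R :=
  \big[Num.max/0]_(X : {set V} | indep M X) cover_weight G X.

(* [Incidence v u x]: while v is being presented, its incident edge vu, of
   weight x, is read. *)
Inductive item (R : realType) (V : finType) :=
| Arrival of V
| Incidence of V & V & R.
Arguments Arrival {R V} _.
Arguments Incidence {R V} _ _ _.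

Definition incidence_stream (R : realType) (V : finType) (G : wgraph R V)
    (s : seq (item R V)) : Prop :=
  exists (order : seq V) (nbr : V -> seq V),
    [/\ perm_eq order (enum V),
        forall v, perm_eq (nbr v) [seq u <- enum V | [set v; u] \in edges G]
      & s = flatten [seq Arrival v ::
                         [seq Incidence v u (weight G [set v; u]) | u <- nbr v]
                    | v <- order]].

(* One variable of memory: it stores either a vertex or a weight. *)
Definition cell (R : realType) (V : finType) := (V + R)%type.

(* The values a variable may hold after an item has been read: the content of
   an existing variable, a vertex or the weight occurring in the item, 0, or an
   existing weight increased by the weight in the item.  Hence a weight
   variable always holds a sum of weights of distinct stream items, which
   rules out packing an unbounded amount of data into a single real number. *)
Inductive storable (R : realType) (V : finType) (mem : seq (cell R V)) :
    item R V -> cell R V -> Prop :=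
| StoreCopy i c : c \in mem -> storable mem i c
| StoreZero i : storable mem i (inr 0)
| StoreArrival v : storable mem (Arrival v) (inl v)
| StoreVertex v u x : storable mem (Incidence v u x) (inl v)
| StoreNeighbour v u x : storable mem (Incidence v u x) (inl u)
| StoreWeight v u x : storable mem (Incidence v u x) (inr x)
| StoreSum v u x y : inr y \in mem ->
    storable mem (Incidence v u x) (inr (y + x)).

(* The memory is the whole state: no control state survives between items.
   Time is unrestricted, so [update] and [output] are arbitrary functions,
   subject to the constraints on what can be stored and output. *)
Record stream_machine (R : realType) (V : finType) := StreamMachine {
  update : seq (cell R V) -> item R V -> seq (cell R V);
  output : seq (cell R V) -> {set V};
  update_storable : forall mem i c, c \in update mem i -> storable mem i c;
  output_stored : forall mem v, v \in output mem -> inl v \in mem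
}.

(* The algorithm is given the ground set and the independence oracle; it knows
   neither the graph nor the order of the stream. *)
Definition stream_algorithm (R : realType) :=
  forall V : finType, pred {set V} -> stream_machine R V.

Definition run (R : realType) (V : finType) (m : stream_machine R V)
    (s : seq (item R V)) : seq (cell R V) :=
  foldl (update m) [::] s.

Definition peak_memory (R : realType) (V : finType) (m : stream_machine R V)
    (s : seq (item R V)) : nat :=
  (\max_(i < (size s).+1) size (run m (take i s)))%N.

Definition extracts (R : realType) (A : stream_algorithm R) (eps : R)
    (V : finType) (G : wgraph R V) (M : matroid V) (space : R) : Prop :=
  forall s : seq (item R V), incidence_stream G s ->
    let m := A V (indep M) in
    let S := output m (run m s) in
    [/\ indep M S,
        cover_weight G S >= (1 - eps) * opt G M
      & (peak_memory m s)%:R <= space].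

(* Main.v *)
(* The same algorithm works for every matroid M, with rank function r.  Fix an
   integer tau with 2 / eps < tau <= 2 / eps + 1 and call a vertex set K sparse
   if |F| <= tau r(F) for every subset F of K, so that |K| <= tau k.  The stream
   keeps a sparse set: each new vertex is inserted and, if sparsity is lost, a
   vertex of minimum weighted degree is evicted from the unique inclusion-minimal
   violator.  Hence every discarded u is spanned by a tight subset D of K
   (|D| = tau r(D)) whose vertices all have weighted degree at least deg u.  The
   weighted degrees of the kept vertices and the weights between them take
   O((tau k)^2) variables.

   Quality.  Let O be an optimal base, A = O :&: K and Q = O :\: K.  Tightness
   and submodularity yield Y in K :\: A with |Y| = tau |Q| and
   deg(Y) >= tau deg(Q) that is sparse in the contraction M / A; by matroid
   partition the tau-fold union of A together with Y splits into tau bases of M.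
   Their average is a fractional base whose relaxed coverage is at least
   (1 - 2 / tau) opt, and the relaxed coverage is convex along exchanges, so it
   can be rounded to a base inside K. *)
Require Import Defs.
From mathcomp Require Import all_boot all_order all_algebra.
From mathcomp Require Import reals zify ring lra.

Set Implicit Arguments.
Unset Strict Implicit.
Unset Printing Implicit Defensive.

Import Order.TTheory GRing.Theory Num.Theory.

(** * Sparsity and tight sets for submodular set functions *)

Section Sparse.
Variable V : finType.
Implicit Types (f : {set V} -> nat) (c : nat) (F K W X Y : {set V}).

Definition submodular f :=
  forall X Y, f (X :|: Y) + f (X :&: Y) <= f X + f Y.

(** The offset [c] serves contractions: for [A] independent, [f F = tau * r (F :|: A)] and
    [c = tau * #|A|] give sparsity in [M / A]. *)
Definition sparse f c K :=
  [forall F : {set V}, (F \subset K) ==> (c + #|F| <= f F)].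

Lemma sparseP f c K :
  reflect (forall F, F \subset K -> c + #|F| <= f F) (sparse f c K).
Proof.
by apply: (iffP forallP) => H F; [exact: (implyP (H F)) | exact/implyP/H].
Qed.

Lemma sparseS f c K K' : K' \subset K -> sparse f c K -> sparse f c K'.
Proof.
move=> sK /sparseP H; apply/sparseP => F sF; exact/H/(subset_trans sF).
Qed.

(** Submodularity makes tight sets ([f F = c + #|F|]) closed under union, and the empty set is
    tight, so the union of all tight subsets is the largest one. *)
Lemma tight_max f c K : submodular f -> f set0 <= c -> sparse f c K ->
  exists W, [/\ W \subset K, f W = c + #|W| &
    forall F, F \subset K -> f F = c + #|F| -> F \subset W].
Proof.
move=> subm f0 /sparseP sp.
pose P F := (F \subset K) && (f F == c + #|F|).
exists (\bigcup_(F | P F) F).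
have /andP[sW /eqP tW]: P (\bigcup_(F | P F) F).
  apply: (big_ind (fun F => is_true (P F))) => //.
  - rewrite /P sub0set cards0 eqn_leq; have := sp set0 (sub0set _).
    by rewrite cards0; lia.
  - move=> X Y /andP[sX /eqP tX] /andP[sY /eqP tY].
    have sXY : X :|: Y \subset K by rewrite subUset sX sY.
    have := subm X Y; have := sp _ sXY; have := cardsUI X Y.
    have := sp (X :&: Y) (subset_trans (subsetIl _ _) sX).
    by rewrite /P sXY /=; lia.
split=> // F sF tF; apply: bigcup_sup; by rewrite /P sF tF /=.
Qed.

(** [F] must contain [u]; in [c + #|F :\ u| <= f (F :\ u) <= f F < c + #|F|] the outer terms differ
    by one, which forces equality up to [f F]. *)
Lemma violator_tight f c K u F : {homo f : X Y / X \subset Y >-> X <= Y} ->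
  sparse f c K -> F \subset u |: K -> f F < c + #|F| ->
  [/\ u \in F, f (F :\ u) = c + #|F :\ u|, f F = f (F :\ u) & F :\ u \subset K].
Proof.
move=> mono /sparseP sp sF vF.
have sFu : F :\ u \subset K by rewrite subDset.
have uF : u \in F.
  apply: contraLR vF => uF; rewrite -leqNgt; apply: sp.
  by move: sFu; rewrite (setDidPl _) // disjoint_sym disjoints1.
have := sp _ sFu; have := cardsD1 u F; have := mono _ _ (subD1set F u).
by rewrite uF; split => //; lia.
Qed.

End Sparse.

(** * Rank function, spans and symmetric exchange *)

Section Rank.
Variable V : finType.
Implicit Types (p : pred {set V}) (A B C D F S X Y : {set V}).

(** Defined for an arbitrary predicate, because the algorithm receives only the oracle. *)
Definition rk p S := \max_(X : {set V} | p X && (X \subset S)) #|X|.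

Lemma rk_mono p : {homo rk p : X Y / X \subset Y >-> X <= Y}.
Proof.
move=> X Y sXY; apply/bigmax_leqP => Z /andP[pZ sZ].
by apply: leq_bigmax_cond; rewrite pZ (subset_trans sZ).
Qed.

Lemma rk_card p S : rk p S <= #|S|.
Proof. by apply/bigmax_leqP => X /andP[_]; apply: subset_leq_card. Qed.

Variable M : matroid V.
Notation r := (rk (indep M)).

Lemma rk_mrank : r setT = mrank M.
Proof. by apply: eq_bigl => X; rewrite subsetT andbT. Qed.

Lemma indep_rk S : indep M S = (r S == #|S|).
Proof.
apply/idP/eqP => [iS|].
  apply/eqP; rewrite eqn_leq rk_card /=.
  by apply: (leq_bigmax_cond (F := fun X : {set V} => #|X|)); rewrite iS subxx.
rewrite /rk.
have [|X /andP[iX sX] ->] := @eq_bigmax_cond _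
  [pred X : {set V} | indep M X && (X \subset S)] (fun X => #|X|).
  by apply/card_gt0P; exists set0; rewrite inE indep0 sub0set.
by move=> eXS; move: iX; rewrite (eqP (_ : X == S)) // eqEcard sX eXS leqnn.
Qed.

Lemma rk_indep S : indep M S -> r S = #|S|.
Proof. by rewrite indep_rk => /eqP. Qed.

Lemma indep_extend A S : indep M A -> A \subset S ->
  exists B, [/\ A \subset B, B \subset S, indep M B & #|B| = r S].
Proof.
move En : (r S - #|A|) => n; elim: n => [|n IH] in A En * => iA sA.
  exists A; split => //; have := @rk_mono (indep M) _ _ sA.
  by rewrite (rk_indep iA); lia.
have [|X /andP[iX sX] eX] := @eq_bigmax_cond _
  [pred X : {set V} | indep M X && (X \subset S)] (fun X => #|X|).
  by apply/card_gt0P; exists set0; rewrite inE indep0 sub0set.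
rewrite -[LHS]/(r S) in eX.
have [|x] := indep_exchange iA iX; first by lia.
rewrite inE => /andP[xA xX] ixA.
have [|//||B [sB ? ? ?]] := IH (x |: A).
- by rewrite cardsU1 xA; lia.
- by rewrite subUset sub1set sA (subsetP sX).
by exists B; split => //; apply: subset_trans sB; apply: subsetUr.
Qed.

(** A base [B0] of [X :&: Y] extends to a base [B] of [X :|: Y]; then [B :&: X] and [B :&: Y] bound
    the two ranks from below, and their intersection contains [B0]. *)
Lemma rk_submodular : submodular r.
Proof.
move=> X Y.
have [B0 [_ sB0 iB0 <-]] := indep_extend (indep0 M) (sub0set (X :&: Y)).
have sU : B0 \subset X :|: Y.
  exact: subset_trans sB0 (subset_trans (subsetIl _ _) (subsetUl _ _)).
have [B [sB0B sB iB <-]] := indep_extend iB0 sU.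
have HX : #|B :&: X| <= r X.
  rewrite -(rk_indep (indep_sub (subsetIl B X) iB)); exact/rk_mono/subsetIr.
have HY : #|B :&: Y| <= r Y.
  rewrite -(rk_indep (indep_sub (subsetIl B Y) iB)); exact/rk_mono/subsetIr.
have := cardsUI (B :&: X) (B :&: Y).
rewrite -setIUr (setIidPl sB) -setIIr => E.
have : #|B0| <= #|B :&: (X :&: Y)| by rewrite subset_leq_card // subsetI sB0B.
lia.
Qed.

Lemma rkU_submodular C : submodular (fun F => r (F :|: C)).
Proof.
by move=> X Y; have := rk_submodular (X :|: C) (Y :|: C); rewrite -setUIl setUACA setUid.
Qed.

Lemma rk_spanS X Y u : X \subset Y -> r (u |: X) = r X -> r (u |: Y) = r Y.
Proof.
move=> sXY e; apply/eqP; rewrite eqn_leq [X in _ && X]rk_mono ?subsetUr // andbT.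
have := rk_submodular (u |: X) Y; rewrite -setUA (setUidPr sXY).
have : r X <= r ((u |: X) :&: Y) by rewrite rk_mono // subsetI subsetUr.
lia.
Qed.

Lemma rk_spanU X Y : (forall u, u \in Y -> r (u |: X) = r X) ->
  r (Y :|: X) = r X.
Proof.
move: {2}#|Y| (erefl #|Y|) => n; elim: n Y => [|n IH] Y cY sp.
  by rewrite (cards0_eq cY) set0U.
have /card_gt0P[u uY] : 0 < #|Y| by rewrite cY.
rewrite -(setD1K uY) -setUA (@rk_spanS X) ?subsetUr ?sp //.
apply: IH => [|v /setD1P[_ vY]]; last exact: sp.
by have := cardsD1 u Y; rewrite uY; lia.
Qed.

(** For [C] a minimal subset of [B'] spanning [u], [u |: C] is the fundamental circuit of [u]. Some
    [v] in [C] lies outside the span of [B :\ u], or else [u] would lie in that span; this [v]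
    serves both exchanges. *)
Lemma sym_exchange B B' u : indep M B -> indep M B' ->
  r setT = #|B| -> r setT = #|B'| -> u \in B :\: B' ->
  exists2 v, v \in B' :\: B &
    indep M (v |: (B :\ u)) /\ indep M (u |: (B' :\ v)).
Proof.
move=> iB iB' rB rB' /setDP[uB uB'].
pose P := [pred F : {set V} | (F \subset B') && (r (u |: F) <= #|F|)].
have PB' : P B' by rewrite /= subxx -rB' rk_mono ?subsetT.
have [C mC _] := minset_exists PB'.
have /andP[sC rC] := minsetp mC.
have [v vC spv] : exists2 v, v \in C & r (v |: (B :\ u)) != r (B :\ u).
  apply/exists_inP/negbNE/negP; rewrite negb_exists_in => /forall_inP H.
  have HC w : w \in C -> r (w |: (B :\ u)) = r (B :\ u).
    by move/H/negbNE/eqP.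
  have e1 := rk_spanU HC.
  have : r (u |: (C :|: (B :\ u))) = r (C :|: (B :\ u)).
    apply: (@rk_spanS C); first exact: subsetUl.
    apply/eqP; rewrite eqn_leq [X in _ && X]rk_mono ?subsetUr // andbT.
    by rewrite (rk_indep (indep_sub sC iB')).
  rewrite setUCA setD1K // e1 => e2.
  have := @rk_mono (indep M) _ _ (subsetUr C B); rewrite e2 (rk_indep iB).
  have := rk_card (indep M) (B :\ u); have := cardsD1 u B; rewrite uB; lia.
have vB' := subsetP sC v vC.
have vu : v != u by apply: contraNneq uB' => <-.
have vBu : v \notin B :\ u.
  by apply: contraNN spv => vBu; rewrite setUC (setUidPl _) // sub1set.
have vB : v \notin B by apply: contraNN vBu; rewrite !inE vu.
exists v; first by rewrite inE vB.
have cB := cardsD1 u B; rewrite uB in cB.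
split.
  rewrite indep_rk eqn_leq rk_card cardsU1 vBu /=.
  have iBu := rk_indep (indep_sub (subD1set B u) iB).
  have : r (B :\ u) <= r (v |: (B :\ u)) by rewrite rk_mono ?subsetUr.
  by move: spv; rewrite iBu; lia.
have uBv : u \notin B' :\ v by rewrite !inE (negPf uB') andbF.
rewrite indep_rk eqn_leq rk_card cardsU1 uBv /=.
(* By minimality of [C], the set [C :\ v] does not span [u]. Submodularity on [u |: C] and
   [u |: (B' :\ v)] transfers this to [B' :\ v]. *)
have HCv : #|C| <= r (u |: (C :\ v)).
  rewrite leqNgt; apply/negP => lt.
  have PCv : P (C :\ v).
    rewrite /= (subset_trans (subD1set C v) sC).
    by have := cardsD1 v C; rewrite vC; lia.
  have := minsetinf mC PCv (subD1set C v); move/setP/(_ v).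
  by rewrite !inE eqxx vC.
have := rk_submodular (u |: C) (u |: (B' :\ v)).
have -> : (u |: C) :|: (u |: (B' :\ v)) = u |: B'.
  apply/setP => x; rewrite !inE; case: eqVneq => //= _.
  by case: eqVneq => [->|_] /=; rewrite ?vC ?vB' //; case: (boolP (x \in C)) => // /(subsetP sC).
have -> : (u |: C) :&: (u |: (B' :\ v)) = u |: (C :\ v).
  apply/setP => x; rewrite !inE; case: eqVneq => //= _.
  by case: (boolP (x \in C)) => [/(subsetP sC)->|]; rewrite ?andbF ?andbT.
have : #|B'| <= r (u |: B') by rewrite -(rk_indep iB') rk_mono ?subsetUr.
have := cardsD1 v B'; rewrite vB'; lia.
Qed.

End Rank.

(** * Online maintenance of a sparse set by eviction *)

Section Kernel.
Variables (R : realType) (V : finType).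
Implicit Types (d deg : V -> R) (F K W U D : {set V}) (tau : nat).

Section Prune.
Variable (f : {set V} -> nat).

Definition min_violator W F :=
  [&& F \subset W, f F < #|F|
    & [forall F' : {set V}, (F' \subset W) && (f F' < #|F'|) ==> (F \subset F')]].

Definition evictable d W x :=
  [exists F : {set V},
    [&& min_violator W F, x \in F & [forall y in F, (d x <= d y)%R]]].

(** The branch [set0] is a default: [evictable_exists] excludes it when [W] is a sparse set with one
    vertex added. *)
Definition prune d W :=
  if sparse f 0 W then W
  else if [pick x | evictable d W x] is Some x then W :\ x else set0.

Hypotheses (mono : {homo f : X Y / X \subset Y >-> X <= Y})
  (subm : submodular f).

(** [U] stands for the vertices presented so far; [D] is the certificate of the discarded [u] and
    may change as the stream goes on. *)
Definition kernel deg U K :=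
  [/\ K \subset U, sparse f 0 K &
      forall u, u \in U :\: K -> exists D,
        [/\ D \subset K, f D = #|D|, f (u |: D) = f D
          & forall x, x \in D -> (deg u <= deg x)%R]].

Lemma kernel_set0 deg : kernel deg set0 set0.
Proof.
split=> [//||u]; last by rewrite inE in_set0 andbF.
by apply/sparseP => F; rewrite subset0 => /eqP->; rewrite cards0.
Qed.

(** After one insertion, [f] falls short of the cardinality by at most one. Submodularity then makes
    the intersection of two violators a violator, so one of least cardinality is contained in all
    others. *)
Lemma evictable_exists d K v : sparse f 0 K -> ~~ sparse f 0 (v |: K) ->
  exists x, evictable d (v |: K) x.
Proof.
move=> sp nsp.
have [F0 vF0] : exists F, (F \subset v |: K) && (f F < #|F|).
  move: nsp; rewrite /sparse negb_forall => /existsP[F].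
  by rewrite negb_imply -ltnNge; exists F.
pose F := [arg min_(F < F0 | (F \subset v |: K) && (f F < #|F|)) #|F|].
have [sF vF mF] : [/\ F \subset v |: K, f F < #|F| &
   forall F', (F' \subset v |: K) && (f F' < #|F'|) -> #|F| <= #|F'|].
  by rewrite /F; case: arg_minnP => // F1 /andP[].
have [vinF tF _ sFK] := violator_tight mono sp sF vF.
pose x := [arg min_(x < v in F) d x]%O.
have [xF xm] : x \in F /\ forall y, y \in F -> (d x <= d y)%R.
  by rewrite /x; case: arg_minP.
exists x; apply/existsP; exists F; rewrite xF /min_violator sF vF /=.
apply/andP; split; last by apply/forall_inP.
apply/forallP => F'; apply/implyP => /andP[sF' vF'].
have le (X : {set V}) : X \subset v |: K -> #|X| <= f X + 1.
  move=> sX; have sXv : X :\ v \subset K by rewrite subDset.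
  have /sparseP/(_ _ sXv) := sp; have := mono (subD1set X v).
  by have := cardsD1 v X; clear; lia.
have sI : F :&: F' \subset v |: K by rewrite (subset_trans (subsetIl _ _)).
have : #|F| <= #|F :&: F'|.
  apply: mF; rewrite sI /=; have := le (F :|: F'); rewrite subUset sF sF'.
  by move: vF vF' (subm F F') (cardsUI F F'); clear; lia.
by move=> H; apply/setIidPl/eqP; rewrite eqEcard subsetIl.
Qed.

(** [d] stands for the degrees read from memory, known on [v |: K] only. The evicted [x] is
    certified by [F :\ x]; an older certificate [D] containing [x] is replaced by
    [(D :|: F) :\ x]. *)
Lemma kernel_step d deg U K v : kernel deg U K -> v \notin U ->
  (forall x, x \in v |: K -> d x = deg x) ->
  kernel deg (v |: U) (prune d (v |: K)).
Proof.
case=> sKU sp wit vU ed; rewrite /prune.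
have vK : v \notin K by apply: contraNN vU; apply/subsetP.
case: ifPn => [spv|nsp].
  split=> //; first exact: setUS.
  move=> u; rewrite !inE negb_or => /andP[/andP[/negPf-> uK] /= uU].
  have [|D [sD tD spD dD]] := wit u; first by rewrite inE uK.
  by exists D; split => //; apply: subset_trans sD (subsetUr _ _).
case: pickP => [x|H]; last by have [x] := evictable_exists d sp nsp; rewrite H.
case/existsP => F /and3P[/and3P[sF vF /forallP minF] xF /forall_inP xm].
have [vinF _ _ sFvK] := violator_tight mono sp sF vF.
(* Every violator contains the least one [F], hence [x]. *)
have spx : sparse f 0 ((v |: K) :\ x).
  apply/sparseP => X; rewrite subsetD1 => /andP[sX xX]; rewrite leqNgt.
  by apply: contraNN xX => vX; have /implyP/(_ _)/subsetP-> := minF X; rewrite ?sX.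
have xW : x \in v |: K by apply: (subsetP sF).
have vFx : f F < 0 + #|F| by [].
have sF' : F \subset x |: ((v |: K) :\ x) by rewrite setD1K.
(* Here [x] plays the part of the last inserted vertex: [F :\ x] is tight and spans [x]. *)
have [_ tFx eFx sFx] := violator_tight mono spx sF' vFx.
have degx y : y \in F -> (deg x <= deg y)%R.
  by move=> yF; rewrite -!ed ?xm // (subsetP sF).
split=> //.
  by apply: subset_trans (subD1set _ _) (setUS _ sKU).
move=> u; case/setDP => uvU; rewrite in_setD1 negb_and negbK => ux.
have [{ux uvU}->|nux] := eqVneq u x.
  exists (F :\ x); rewrite setD1K //; split => // y /setD1P[_ yF].
  exact: degx.
rewrite (negPf nux) /= in ux.
have uv : u != v by apply: contraNneq ux => ->; rewrite setU11.
have uUK : u \in U :\: K.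
  rewrite in_setD; move: ux uvU; rewrite !in_setU1 (negPf uv) /= => -> //.
have [D [sD tD spD dD]] := wit u uUK.
have sDW : D \subset v |: K by apply: subset_trans sD (subsetUr _ _).
case: (boolP (x \in D)) => xD; last first.
  by exists D; rewrite subsetD1 sDW xD.
have vD : v \notin D by apply: contraNN vK; apply/subsetP.
have sDF : D :|: F \subset x |: ((v |: K) :\ x) by rewrite setD1K // subUset sDW.
(* [D] is tight and [D :&: F] lies in the sparse set [K], so submodularity passes the violation from
   [F] to [D :|: F]. *)
have vDF : f (D :|: F) < 0 + #|D :|: F|.
  have /sparseP/(_ (D :&: F)) := sp.
  move=> /(_ (subset_trans (subsetIl _ _) sD)).
  have := subm D F; have := cardsUI D F; move: tD vF; clear; lia.
have [_ tDF eDF sDFx] := violator_tight mono spx sDF vDF.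
exists ((D :|: F) :\ x); split => //.
  rewrite -eDF; apply/eqP; rewrite eqn_leq; apply/andP; split; last first.
    by rewrite eDF mono // subsetUr.
  have := subm (u |: D) (D :|: F); rewrite -setUA (setUA D) setUid spD.
  have : f (u |: ((D :|: F) :\ x)) <= f (u |: (D :|: F)).
    by rewrite mono // setUS // subD1set.
  have : f D <= f ((u |: D) :&: (D :|: F)).
    by rewrite mono // subsetI subsetUr subsetUl.
  clear; lia.
move=> y /setD1P[_]; rewrite in_setU => /orP[/dD //|yF].
by apply: le_trans (degx y yF); apply: dD.
Qed.

End Prune.
End Kernel.

(** * Matroid partition, and augmentation in a contraction *)

Section Union.
Variables (V : finType) (M : matroid V).
Notation r := (rk (indep M)).
Implicit Types (A D F K Q S X Y : {set V}) (tau : nat).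

Lemma sum_rkU_submodular n (C : 'I_n -> {set V}) :
  submodular (fun F => \sum_i r (F :|: C i)).
Proof.
move=> X Y; rewrite -!big_split leq_sum // => i _.
exact: (rkU_submodular M (C i) X Y).
Qed.

(** The elements of [Y] are handed out one at a time. If no [C i] could take [e], then in each
    contraction by [C i] some tight set would span [e], hence so would the largest tight set [W],
    and [e |: W] would violate sparsity. *)
Lemma matroid_partition n (C : 'I_n -> {set V}) Y :
  (forall i, [disjoint C i & Y]) ->
  sparse (fun F => \sum_i r (F :|: C i)) (\sum_i #|C i|) Y ->
  exists C' : 'I_n -> {set V},
    [/\ forall i, C i \subset C' i, forall i, indep M (C' i)
      & forall v, \sum_i (v \in C' i) = \sum_i (v \in C i) + (v \in Y)].
Proof.
move: {2}#|Y| (erefl #|Y|) => m; elim: m Y C => [|m IH] Y C cY dCY sp.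
  move: cY sp => /cards0_eq-> /sparseP/(_ set0 (sub0set _)).
  rewrite cards0 addn0 => le; exists C; split=> // [i|v]; last by rewrite inE addn0.
  rewrite indep_rk eqn_leq rk_card /=; rewrite leqNgt; apply/negP => lt.
  move: le; rewrite leqNgt => /negP; apply.
  rewrite (bigD1 i) //= [ltnRHS](bigD1 i) //= -addSn leq_add ?set0U //.
  by apply: leq_sum => j _; rewrite set0U rk_card.
have /card_gt0P[e eY] : 0 < #|Y| by rewrite cY.
have cYe : #|Y :\ e| = m by have := cardsD1 e Y; rewrite eY; lia.
have eC i : e \notin C i by apply/negP => /(disjointFr (dCY i)); rewrite eY.
pose Ce i j := if j == i then e |: C j else C j.
have cCe i : \sum_j #|Ce i j| = (\sum_j #|C j|).+1.
  rewrite (bigD1 i) //= [in RHS](bigD1 i) //= /Ce eqxx cardsU1 eC.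
  by rewrite add1n addSn; congr (_ + _).+1; apply: eq_bigr => j /negPf->.
pose f F := \sum_i r (F :|: C i); pose c := \sum_j #|C j|.
have [/existsP[i spi]|] := boolP [exists i,
    sparse (fun F => \sum_j r (F :|: Ce i j)) (\sum_j #|Ce i j|) (Y :\ e)].
  have [j|C' [sC iC eC']] := IH _ _ cYe _ spi.
    rewrite /Ce; case: eqP => _; last exact: disjointWr (subD1set _ _) (dCY j).
    rewrite disjoint_sym -setI_eq0 setIUr setU_eq0 !setI_eq0.
    rewrite disjoint_sym disjoints1 !inE eqxx /= disjoint_sym.
    exact: disjointWr (subD1set _ _) (dCY j).
  exists C'; split=> // [j|v].
    apply: subset_trans (sC j); rewrite /Ce; case: eqP => // _; exact: subsetUr.
  rewrite eC' in_setD1 (bigD1 i) //= [in RHS](bigD1 i) //= /Ce eqxx in_setU1.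
  rewrite [X in _ + X + _](eq_bigr (fun j => (v \in C j) : nat)); last first.
    by move=> j /negPf->.
  by case: eqVneq => [->|] /=; rewrite ?eY ?(negPf (eC i)); lia.
rewrite negb_exists => /forallP nsp.
have subf : submodular f by apply: sum_rkU_submodular.
have f0 : f set0 <= c by apply: leq_sum => i _; rewrite set0U rk_card.
have [W [sW tW maxW]] := tight_max subf f0 (sparseS (subD1set Y e) sp).
(* Giving [e] to part [i] raises the offset by one, so a violator [F] of the new condition is tight
   for the old one and spans [e] together with [C i]. *)
have spanW i : r (e |: (W :|: C i)) = r (W :|: C i).
  have := nsp i; rewrite negb_forall => /existsP[F].
  rewrite negb_imply -ltnNge cCe => /andP[sF vF].
  have /sparseP/(_ F (subset_trans sF (subD1set _ _))) := sp.
  rewrite -/(f F) -/c => spF.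
  set s := \sum_(j < n | j != i) r (F :|: C j).
  have fE : f F = r (F :|: C i) + s by rewrite /f (bigD1 i).
  have fE' : \sum_j r (F :|: Ce i j) = r (e |: (F :|: C i)) + s.
    rewrite (bigD1 i) //= /Ce eqxx setUCA; congr (_ + _).
    by apply: eq_bigr => j /negPf->.
  have [tF eF] : f F = c + #|F| /\ r (e |: (F :|: C i)) = r (F :|: C i).
    have := rk_mono (indep M) (subsetUr [set e] (F :|: C i)).
    by move: vF spF; rewrite fE fE' -/c; clear; lia.
  exact/(rk_spanS _ eF)/setSU/maxW.
have : f (e |: W) = f W by apply: eq_bigr => i _; rewrite -setUA spanW.
have sWY : e |: W \subset Y.
  by rewrite subUset sub1set eY (subset_trans sW) ?subD1set.
have eW : e \notin W by apply/negP => /(subsetP sW); rewrite !inE eqxx.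
have /sparseP/(_ _ sWY) := sp; rewrite -/(f _) -/c cardsU1 eW tW; lia.
Qed.

(** Let [D] and [W] be the largest tight subsets of [K] and, modulo [A], of [Y]. If no vertex could
    be added, [W] would span, modulo [A], the part of [D] outside [Y]. As [D] spans [Q], counting
    would give [tau * #|Q| <= #|Y|]. *)
Lemma sparse_augment tau A Q K Y :
  indep M (A :|: Q) -> [disjoint A & Q] ->
  sparse (fun F => tau * r F) 0 K ->
  (forall q, q \in Q -> exists D,
     [/\ D \subset K, tau * r D = #|D| & r (q |: D) = r D]) ->
  Y \subset K :\: A ->
  sparse (fun F => tau * r (F :|: A)) (tau * #|A|) Y -> #|Y| < tau * #|Q| ->
  exists2 u, u \in K :\: A :\: Y
    & sparse (fun F => tau * r (F :|: A)) (tau * #|A|) (u |: Y).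
Proof.
move=> iAQ dAQ spK wit sYK spY ltY.
set fA := fun F => _ in spY *.
apply/exists_inP/negbNE/negP; rewrite negb_exists_in => /forall_inP nsp.
have iA := indep_sub (subsetUl A Q) iAQ.
have subm : submodular (fun F => tau * r F).
  by move=> X1 X2; rewrite -!mulnDr leq_mul2l rk_submodular orbT.
have submA : submodular fA.
  by move=> X1 X2; rewrite -!mulnDr leq_mul2l (rkU_submodular M A X1 X2) orbT.
have monoA : {homo fA : X1 X2 / X1 \subset X2 >-> X1 <= X2}.
  by move=> X1 X2 sX; rewrite leq_mul2l rk_mono ?orbT // setSU.
have f0 : tau * r set0 <= 0 by have := rk_card (indep M) set0; rewrite cards0; lia.
have fA0 : fA set0 <= tau * #|A| by rewrite /fA set0U (rk_indep iA).
have [D [sD tD maxD]] := tight_max subm f0 spK.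
have [W [sW tW maxW]] := tight_max submA fA0 spY.
have tau0 : 0 < tau by case: tau ltY {spK spY fA nsp subm submA monoA f0 fA0 tD maxD tW maxW wit}.
have rAD : #|A| + #|Q| <= r (A :|: D).
  have spD q : q \in Q -> r (q |: (A :|: D)) = r (A :|: D).
    move=> qQ; have [D' [sD' tD' spq]] := wit q qQ.
    apply: (rk_spanS _ spq); apply: subset_trans (maxD D' sD' tD') _.
    exact: subsetUr.
  rewrite -(rk_spanU spD).
  have /eqP <- : #|A :|: Q| == #|A| + #|Q| by rewrite (leq_card_setU A Q).2.
  rewrite -(rk_indep iAQ) rk_mono //.
  by rewrite setUCA setUA subsetUl.
have spW u : u \in (D :\: A) :\: Y -> fA (u |: W) = fA W.
  case/setDP => /setDP[uD uA] uY.
  have := nsp u; rewrite !in_setD uY uA (subsetP sD) // => /(_ isT).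
  rewrite negb_forall => /existsP[F]; rewrite negb_imply -ltnNge => /andP[sF vF].
  have [uF tF eF sFY] := violator_tight monoA spY sF vF.
  have sFW := maxW _ sFY tF.
  apply/eqP; rewrite eqn_leq [X in _ && X]monoA ?subsetUr // andbT.
  have := submA F W.
  have -> : F :|: W = u |: W.
    by rewrite -{1}(setD1K uF) -setUA (setUidPr sFW).
  have : fA (F :\ u) <= fA (F :&: W) by rewrite monoA // subsetI subD1set.
  by rewrite eF; move: (fA _) (fA _) (fA _) (fA _); clear; lia.
have spWall : fA ((D :\: A :\: Y) :|: W) = fA W.
  rewrite /fA -setUA; congr (_ * _); apply: rk_spanU => u /spW /eqP.
  by rewrite eqn_pmul2l // -setUA => /eqP.
(* [F] collects the vertices of [D :\: A] that are outside [Y] or in [W]. Modulo [A] its rank is at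
   most that of [W], and the rest of [D :\: A] lies in [Y :\: W]. *)
pose F := (D :\: A) :&: ((D :\: A :\: Y) :|: W).
have fF : fA F <= fA W by rewrite -spWall monoA // subsetIr.
have cY : #|W| + #|(D :\: A) :\: F| <= #|Y|.
  have dWF : [disjoint W & (D :\: A) :\: F].
    apply/pred0P => x /=; rewrite /F !inE.
    by case: (x \in W); case: (x \in A); case: (x \in D); rewrite ?orbT.
  have /eqP <- : #|W :|: ((D :\: A) :\: F)| == #|W| + #|(D :\: A) :\: F|.
    by rewrite (leq_card_setU _ _).2.
  apply/subset_leq_card; rewrite subUset sW; apply/subsetP => x.
  rewrite /F !inE.
  by case: (x \in Y); case: (x \in A); case: (x \in D); rewrite ?andbF ?orbF.
have sFD : F :|: (D :&: A) \subset D.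
  by rewrite subUset subsetIl (subset_trans (subsetIl _ _)) ?subsetDl.
have cD : #|(D :\: A) :\: F| + #|F :|: (D :&: A)| = #|D|.
  rewrite -(cardsID (F :|: (D :&: A)) D) (setIidPr sFD) addnC.
  congr (_ + #|pred_of_set _|); apply/setP => x; rewrite !inE.
  by case: (x \in A); case: (x \in D); rewrite ?andbT ?andbF ?orbF ?orbT.
(* This yields [tau * r (A :|: D) + #|F :|: (D :&: A)| <= tau * #|A| + #|W| + #|D|], which [rAD],
   [cD] and [cY] turn into [tau * #|Q| <= #|Y|]. *)
have := leq_mul (leqnn tau) (rk_submodular M (F :|: A) D).
have sF : F \subset D by apply: subset_trans sFD; apply: subsetUl.
rewrite -setUA (setUidPr (subset_trans sF (subsetUr A D))).
rewrite setIUl (setIidPl sF) (setIC A D).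
have := leq_mul (leqnn tau) rAD; rewrite !mulnDr.
have /sparseP/(_ _ (subset_trans sFD sD)) := spK.
rewrite tW {1}/fA in fF; move: tD fF ltY cD cY; clear; lia.
Qed.

End Union.

(** * Heavy replacements for the discarded vertices of an optimum *)

Section Quality.
Variables (R : realType) (V : finType) (M : matroid V).
Notation r := (rk (indep M)).
Implicit Types (A B K O Q S X Y : {set V}) (tau n : nat).
Local Open Scope ring_scope.

(** A vertex [q] of least degree in [Q] is treated last. The certificates of all vertices of [Q]
    consist of vertices of degree at least [deg q], so [sparse_augment] applies [tau] times among
    these. *)
Lemma heavy_selection (deg : V -> R) tau U K A Q : (0 < tau)%N ->
  kernel (fun F => (tau * r F)%N) deg U K -> Q \subset U :\: K ->
  indep M (A :|: Q) -> [disjoint A & Q] ->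
  exists Y, [/\ Y \subset K :\: A,
    sparse (fun F => tau * r (F :|: A))%N (tau * #|A|) Y,
    #|Y| = (tau * #|Q|)%N & tau%:R * \sum_(q in Q) deg q <= \sum_(y in Y) deg y].
Proof.
move=> tau0 [sKU spK wit].
(* The claim is strengthened by a degree bound for each single [y], which places [Y'] inside the
   threshold set [Kt]. *)
suff H : Q \subset U :\: K -> indep M (A :|: Q) -> [disjoint A & Q] ->
  exists Y, [/\ Y \subset K :\: A,
    sparse (fun F => tau * r (F :|: A))%N (tau * #|A|) Y,
    #|Y| = (tau * #|Q|)%N, tau%:R * \sum_(q in Q) deg q <= \sum_(y in Y) deg y
    & forall y, y \in Y -> exists2 q, q \in Q & deg q <= deg y].
  by move=> sQ iQ dQ; have [Y [? ? ? ? _]] := H sQ iQ dQ; exists Y.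
move En: #|Q| => m; elim: m Q En => [|m IH] Q En sQ iQ dQ.
  exists set0; rewrite cards0 muln0 (cards0_eq En) !big_set0 mulr0.
  split=> [||//||y]; rewrite ?sub0set ?lexx ?inE //.
  apply/sparseP => F; rewrite subset0 => /eqP->.
  by rewrite cards0 set0U rk_indep ?addn0 // (indep_sub _ iQ) ?subsetUl.
have /card_gt0P[q0 q0Q] : (0 < #|Q|)%N by rewrite En.
pose q := [arg min_(x < q0 in Q) deg x]%O.
have [qQ qm] : q \in Q /\ forall x, x \in Q -> deg q <= deg x.
  by rewrite /q; case: arg_minP.
have sQq : Q :\ q \subset Q by apply: subD1set.
have cQq : #|Q :\ q| = m by have := cardsD1 q Q; rewrite qQ En => -[].
have [||Y' [sY' spY' cY' dY' mY']] := IH _ cQq (subset_trans sQq sQ).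
- by apply: indep_sub iQ; apply: setUS.
- exact: disjointWr dQ.
have sumQ : \sum_(x in Q) deg x = deg q + \sum_(x in Q :\ q) deg x.
  rewrite (bigD1 q) //=; congr (_ + _); apply: eq_bigl => x.
  by rewrite !inE andbC.
have {}mY' y : y \in Y' -> deg q <= deg y.
  by move/mY' => [x /(subsetP sQq)/qm]; apply: le_trans.
pose Kt := [set x in K | deg q <= deg x].
have sKt : Kt \subset K by apply/subsetP => x; rewrite inE => /andP[].
suff H n : (n <= tau)%N -> exists Y, [/\ Y \subset Kt :\: A,
    sparse (fun F => tau * r (F :|: A))%N (tau * #|A|) Y,
    #|Y| = (tau * m + n)%N
    & tau%:R * \sum_(x in Q :\ q) deg x + n%:R * deg q <= \sum_(y in Y) deg y].
  have [Y [sY spY cY dY]] := H tau (leqnn _).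
  exists Y; split=> //.
  - exact: subset_trans sY (setSD _ sKt).
  - by rewrite cY mulnS addnC.
  - by rewrite sumQ mulrDr addrC.
  - move=> y /(subsetP sY); rewrite !inE => /andP[_ /andP[_ le]]; by exists q.
elim: n => [|n IHn] ltn.
  exists Y'; rewrite mul0r addr0 addn0; split => //.
  apply/subsetP => y yY'; rewrite in_setD inE mY' // andbT -in_setD.
  exact: (subsetP sY').
have [Y [sY spY cY dY]] := IHn (ltnW ltn).
have [||u] := sparse_augment iQ dQ (sparseS sKt spK) _ sY spY.
- move=> x xQ; have [D [sD tD spD dD]] := wit x (subsetP sQ x xQ).
  exists D; split=> //.
    apply/subsetP => y yD; rewrite inE (subsetP sD) //=.
    exact: le_trans (qm x xQ) (dD y yD).
  by move/eqP: spD; rewrite eqn_pmul2l // => /eqP.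
- by rewrite cY En mulnS addnC ltn_add2r.
case/setDP => uK uY spu.
exists (u |: Y); split=> //.
- by rewrite subUset sub1set uK.
- by rewrite cardsU1 uY cY addnCA.
rewrite big_setU1 //= -natr1 mulrDl mul1r addrCA addrA addrC; apply: lerD => //.
  by move: uK; rewrite !inE => /andP[_ /andP[_]].
by rewrite addrC.
Qed.

(** * Rounding a fractional base along exchanges *)

Section Rounding.
Variable w : V -> V -> R.
Hypotheses (w_sym : forall u v, w u v = w v u)
  (w_ge0 : forall u v, 0 <= w u v) (w_diag : forall u, w u u = 0).

(** Over ordered pairs, this is [tau ^ 2] times the multilinear coverage [x + y - x * y], with [x]
    and [y] the values of [c / tau] at the two ends. *)
Definition fcover tau (c : V -> R) : R :=
  \sum_u \sum_v w u v * (tau%:R * (c u + c v) - c u * c v).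

Definition mult n (B : {ffun 'I_n -> {set V}}) (v : V) : nat :=
  \sum_i (v \in B i).

(** The second difference along the exchange is a quadratic form with zero diagonal; it equals
    [4 * w u v]. *)
Lemma fcover_exchange tau (c d : V -> R) u v : u != v ->
  (forall x, d x = (x == v)%:R - (x == u)%:R) ->
  2 * fcover tau c <=
  fcover tau (fun x => c x + d x) + fcover tau (fun x => c x - d x).
Proof.
move=> uv ed.
have sum_d (g : V -> R) : \sum_x g x * d x = g v - g u.
  under eq_bigr => x _ do rewrite ed mulrBr.
  rewrite sumrB; congr (_ - _).
    rewrite (bigD1 v) //= eqxx mulr1 big1 ?addr0 // => x /negPf->.
    by rewrite mulr0.
  rewrite (bigD1 u) //= eqxx mulr1 big1 ?addr0 // => x /negPf->.
  by rewrite mulr0.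
have e : fcover tau (fun x => c x + d x) + fcover tau (fun x => c x - d x)
    = 2 * fcover tau c - 2 * \sum_x (\sum_y w x y * d y) * d x.
  rewrite /fcover !mulr_sumr -!big_split -sumrB; apply: eq_bigr => x _ /=.
  rewrite mulr_suml !mulr_sumr -!big_split -sumrB; apply: eq_bigr => y _ /=.
  by ring.
rewrite e sum_d !sum_d !w_diag (w_sym v u).
by have := w_ge0 u v; lra.
Qed.

Lemma sqr_exchange (c d : V -> R) v : d v != 0 ->
  2 * \sum_x c x ^+ 2 < \sum_x (c x + d x) ^+ 2 + \sum_x (c x - d x) ^+ 2.
Proof.
move=> dv; have -> : \sum_x (c x + d x) ^+ 2 + \sum_x (c x - d x) ^+ 2
    = 2 * \sum_x c x ^+ 2 + 2 * \sum_x d x ^+ 2.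
  by rewrite !mulr_sumr -!big_split; apply: eq_bigr => x _ /=; ring.
rewrite ltrDl mulr_gt0 // (bigD1 v) //=.
rewrite ltr_wpDr ?exprn_even_gt0 // sumr_ge0 // => x _; exact: sqr_ge0.
Qed.

Lemma mult_swap n (B : {ffun 'I_n -> {set V}}) i (u v x : V) :
  u \in B i -> v \notin B i ->
  (mult [ffun k => if k == i then v |: (B i :\ u) else B k] x)%:R =
  (mult B x)%:R + ((x == v)%:R - (x == u)%:R) :> R.
Proof.
move=> uB vB; apply/eqP; rewrite addrA eq_sym subr_eq eq_sym -!natrD eqr_nat.
apply/eqP; rewrite /mult (bigD1 i) //= ffunE eqxx.
rewrite [in RHS](bigD1 i) //=.
rewrite (eq_bigr (fun k => (x \in B k) : nat)) => [|k /negPf nk]; last first.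
  by rewrite ffunE nk.
rewrite !inE; have uv : u != v by apply: contraNneq vB => <-.
case: (eqVneq x v) => [->|xv] /=.
  by rewrite (negPf vB) eq_sym (negPf uv); lia.
by case: (eqVneq x u) => [->|xu] /=; rewrite ?uB; lia.
Qed.

(* Among the n-tuples of bases of M inside K, take one that maximises the
   relaxed objective and then the sum of the squared multiplicities.  Both are
   midpoint convex along an exchange, the second one strictly, so that two
   distinct members could be exchanged for a better tuple. *)
Lemma rounding n K (B : 'I_n -> {set V}) : (0 < n)%N ->
  (forall i, [/\ indep M (B i), #|B i| = r setT & B i \subset K]) ->
  exists S, [/\ S \subset K, indep M S &
    fcover n (fun v => (mult (finfun B) v)%:R) <=
    fcover n (fun v => n%:R * (v \in S)%:R)].
Proof.
move=> n0 HB.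
pose P (B : {ffun 'I_n -> {set V}}) :=
  [forall i, [&& indep M (B i), #|B i| == r setT & B i \subset K]].
pose Fo (B : {ffun 'I_n -> {set V}}) := fcover n (fun v => (mult B v)%:R).
pose Qo (B : {ffun 'I_n -> {set V}}) : R := \sum_v (mult B v)%:R ^+ 2.
have PB : P (finfun B).
  by apply/forallP => i; rewrite ffunE; have [-> -> ->] := HB i; rewrite eqxx.
pose B1 := [arg max_(Z > finfun B | P Z) Fo Z]%O.
have [PB1 mB1] : P B1 /\ forall Z, P Z -> Fo Z <= Fo B1.
  by rewrite /B1; case: arg_maxP.
pose B2 := [arg max_(Z > B1 | P Z && (Fo Z == Fo B1)) Qo Z]%O.
have [/andP[/forallP PB2 /eqP FB2] mB2] : P B2 && (Fo B2 == Fo B1) /\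
    forall Z, P Z && (Fo Z == Fo B1) -> Qo Z <= Qo B2.
  by rewrite /B2; case: arg_maxP; rewrite ?PB1 ?eqxx.
have eB i j : B2 i = B2 j.
  apply: contraTeq isT => nij.
  have /and3P[iBi /eqP cBi sBi] := PB2 i; have /and3P[iBj /eqP cBj sBj] := PB2 j.
  have [u uij] : exists u, u \in B2 i :\: B2 j.
    apply/set0Pn; rewrite setD_eq0; apply: contraNN nij => s.
    by rewrite eqEcard s cBi cBj leqnn.
  have [v vji [iBu iBv]] := sym_exchange iBi iBj (esym cBi) (esym cBj) uij.
  have /setDP[ui uj] := uij; have /setDP[vj vi] := vji.
  have uv : u != v by apply: contraNneq vi => <-.
  pose Bp := [ffun k => if k == i then v |: (B2 i :\ u) else B2 k].
  pose Bm := [ffun k => if k == j then u |: (B2 j :\ v) else B2 k].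
  have card_swap X x y : x \in X -> y \notin X -> #|y |: (X :\ x)| = #|X|.
    move=> xX yX; rewrite cardsU1 !inE (negPf yX) andbF.
    by have := cardsD1 x X; rewrite xX.
  have PBp : P Bp.
    apply/forallP => k; rewrite ffunE; case: eqP => [_|_]; last exact: PB2.
    rewrite iBu card_swap // cBi eqxx subUset sub1set (subsetP sBj) //=.
    exact: subset_trans (subD1set _ _) sBi.
  have PBm : P Bm.
    apply/forallP => k; rewrite ffunE; case: eqP => [_|_]; last exact: PB2.
    rewrite iBv card_swap // cBj eqxx subUset sub1set (subsetP sBi) //=.
    exact: subset_trans (subD1set _ _) sBj.
  pose d (x : V) : R := (x == v)%:R - (x == u)%:R.
  pose c (x : V) : R := (mult B2 x)%:R.
  have cp x : (mult Bp x)%:R = c x + d x :> R by apply: mult_swap.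
  have cm x : (mult Bm x)%:R = c x - d x :> R.
    by rewrite /Bm mult_swap // /d opprB.
  have eqF Z c' : (forall x, (mult Z x)%:R = c' x :> R) -> Fo Z = fcover n c'.
    by move=> e; apply: eq_bigr => x _; apply: eq_bigr => y _; rewrite !e.
  have eqQ Z c' : (forall x, (mult Z x)%:R = c' x :> R) ->
      Qo Z = \sum_x c' x ^+ 2.
    by move=> e; apply: eq_bigr => x _; rewrite e.
  have := fcover_exchange n c uv (fun x => erefl (d x)).
  rewrite -(eqF _ _ cp) -(eqF _ _ cm) -(eqF B2 c) // FB2 => leF.
  have Fp := mB1 _ PBp; have Fm := mB1 _ PBm.
  (* Two values at most [Fo B1] whose sum is at least [2 * Fo B1] both equal it, so [Bp] and [Bm]
     compete in the second maximisation. *)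
  have Qp : Qo Bp <= Qo B2 by apply: mB2; rewrite PBp eq_le Fp /=; lra.
  have Qm : Qo Bm <= Qo B2 by apply: mB2; rewrite PBm eq_le Fm /=; lra.
  have dv : d v != 0.
    by rewrite /d eqxx (eq_sym v u) (negPf uv) subr0 oner_eq0.
  have := sqr_exchange c dv.
  by rewrite -(eqQ _ _ cp) -(eqQ _ _ cm) -(eqQ B2 c) //; lra.
pose i0 := Ordinal n0.
have /and3P[iS _ sS] := PB2 i0.
exists (B2 i0); split=> //.
apply: le_trans (mB1 _ PB) _; rewrite -FB2 le_eqVlt; apply/orP; left; apply/eqP.
have e x : (mult B2 x)%:R = n%:R * (x \in B2 i0)%:R :> R.
  rewrite /mult (eq_bigr (fun=> (x \in B2 i0) : nat)) => [|i _]; last by rewrite (eB i i0).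
  by rewrite sum_nat_const card_ord natrM.
by apply: eq_bigr => x _; apply: eq_bigr => y _; rewrite !e.
Qed.

End Rounding.
End Quality.

(** * Coverage as a sum over ordered pairs of vertices *)

Section Graph.
Variables (R : realType) (V : finType) (G : wgraph R V).
Implicit Types (A C K O Q S X Y : {set V}).
Local Open Scope ring_scope.

Definition wadj (u v : V) : R :=
  if [set u; v] \in edges G then weight G [set u; v] else 0.

Definition wdeg (v : V) : R := \sum_u wadj v u.

Lemma wadj_sym u v : wadj u v = wadj v u.
Proof. by rewrite /wadj setUC. Qed.

Lemma wadj_ge0 u v : 0 <= wadj u v.
Proof. by rewrite /wadj; case: ifP => // /weight_ge0. Qed.

Lemma wadj_diag u : wadj u u = 0.
Proof.
by rewrite /wadj; case: ifP => // /edges_card2; rewrite setUid cards1.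
Qed.

Definition cover2 S : R :=
  \sum_u \sum_v wadj u v * ((u \in S) || (v \in S))%:R.

Lemma cover_weight2 S : 2 * cover_weight G S = cover2 S.
Proof.
rewrite /cover2 pair_bigA /= /cover_weight.
pose h (p : V * V) := [set p.1; p.2].
pose F (e : {set V}) : R := weight G e * (e :&: S != set0)%:R.
transitivity (\sum_(p | h p \in edges G) F (h p)); last first.
  rewrite big_mkcond; apply: eq_bigr => -[u v] _; rewrite /F /h /wadj /=.
  case: ifP; rewrite ?mul0r //= => _; congr (_ * _%:R).
  congr nat_of_bool; apply/set0Pn/orP => [[x]|[uS|vS]].
  - by rewrite !inE => /andP[/orP[]/eqP-> ->]; [left|right].
  - by exists u; rewrite !inE eqxx.
  - by exists v; rewrite !inE eqxx orbT.
(* Ordered pairs are grouped by the edge they form; each edge arises from exactly two. *)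
rewrite (partition_big h (mem (edges G))) //= mulr_sumr big_mkcondr /=.
apply: eq_bigr => e eG.
have /eqP/cards2P[a [b [ab eab]]] := edges_card2 eG.
rewrite {e}eab in eG *.
rewrite (eq_bigr (fun=> F [set a; b])) => [|p /andP[_ /eqP->] //].
rewrite sumr_const.
have -> : #|[pred p | (h p \in edges G) && (h p == [set a; b])]| = 2%N.
  have -> : 2%N = #|[set (a, b); (b, a)]|.
    by rewrite cards2 xpair_eqE negb_and ab.
  apply: eq_card => -[u v]; rewrite !inE /h /= !xpair_eqE.
  apply/andP/idP => [[_ /eqP e']|].
    have : u \in [set a; b] by rewrite -e' set21.
    have : v \in [set a; b] by rewrite -e' set22.
    have : a \in [set u; v] by rewrite e' set21.
    have : b \in [set u; v] by rewrite e' set22.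
    rewrite !inE ![a == _]eq_sym ![b == _]eq_sym.
    case: (eqVneq u a) => [->|_] /=.
      by rewrite (negPf ab) /= => ->.
    by move=> _ -> _ ->.
  case/orP => /andP[/eqP-> /eqP->]; first by rewrite eqxx.
  by rewrite setUC eqxx.
by rewrite /F; case: ifP; rewrite ?mulr1 ?mulr0 ?mul0rn ?mulr_natl.
Qed.

End Graph.

(** * Quality of the best independent set inside the kernel *)

Section KernelQuality.
Variables (R : realType) (V : finType) (G : wgraph R V) (M : matroid V).
Notation r := (rk (indep M)).
Implicit Types (A C K O Q S X Y : {set V}) (tau : nat).
Local Open Scope ring_scope.

Lemma sum_wadj_in Y :
  \sum_u \sum_v wadj G u v * ((u \in Y)%:R + (v \in Y)%:R)
  = 2 * \sum_(y in Y) wdeg G y.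
Proof.
have -> : \sum_(y in Y) wdeg G y = \sum_u \sum_v wadj G u v * (u \in Y)%:R.
  rewrite big_mkcond; apply: eq_bigr => u _; rewrite -mulr_suml.
  by case: (u \in Y); rewrite ?mulr1 ?mulr0.
have e : \sum_u \sum_v wadj G u v * (v \in Y)%:R
    = \sum_u \sum_v wadj G u v * (u \in Y)%:R.
  rewrite exchange_big; apply: eq_bigr => u _; apply: eq_bigr => v _.
  by rewrite wadj_sym.
rewrite mulr_natl mulr2n -{2}e -big_split; apply: eq_bigr => u _ /=.
by rewrite -big_split; apply: eq_bigr => v _ /=; rewrite mulrDr.
Qed.

Lemma cover2_le (h : V -> V -> R) S :
  (forall u v, ((u \in S) || (v \in S))%:R <= h u v) ->
  cover2 G S <= \sum_u \sum_v wadj G u v * h u v.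
Proof.
move=> H; apply: ler_sum => u _; apply: ler_sum => v _.
by apply: ler_wpM2l (H u v); apply: wadj_ge0.
Qed.

Lemma cover_weight_mono S X : S \subset X ->
  cover_weight G S <= cover_weight G X.
Proof.
move=> /subsetP sSX.
suff : 2 * cover_weight G S <= 2 * cover_weight G X by rewrite ler_pM2l.
rewrite !cover_weight2; apply: cover2_le => u v; rewrite ler_nat.
case: (boolP (u \in S)) => [/sSX->//|_] /=.
by case: (boolP (v \in S)) => [/sSX->|//]; rewrite orbT.
Qed.

Lemma opt_ge S : indep M S -> cover_weight G S <= opt G M.
Proof. by move=> iS; apply: (le_bigmax_cond _ (cover_weight G)). Qed.

(** Coverage is monotone, so extending a set to a base loses nothing. *)
Lemma opt_base : exists O,
  [/\ indep M O, #|O| = r setT & opt G M <= cover_weight G O].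
Proof.
have [B0 [_ _ iB0 cB0]] := indep_extend (indep0 M) (subsetT set0).
pose O := [arg max_(X > B0 | indep M X && (#|X| == r setT)) cover_weight G X]%O.
have [/andP[iO /eqP cO] mO] : indep M O && (#|O| == r setT) /\ forall X,
    indep M X && (#|X| == r setT) -> cover_weight G X <= cover_weight G O.
  by rewrite /O; case: arg_maxP; rewrite ?iB0 ?cB0 ?eqxx.
exists O; split=> //; apply: bigmax_le.
  by apply: sumr_ge0 => e /andP[eG _]; apply: weight_ge0.
move=> X iX; have [B [sXB _ iB cB]] := indep_extend iX (subsetT X).
by apply: le_trans (cover_weight_mono sXB) (mO B _); rewrite iB cB eqxx.
Qed.

Lemma fcover_indicator tau S :
  fcover (wadj G) tau (fun v => tau%:R * (v \in S)%:R)
  = tau%:R ^+ 2 * cover2 G S.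
Proof.
rewrite mulr_sumr; apply: eq_bigr => u _; rewrite mulr_sumr.
apply: eq_bigr => v _.
by case: (u \in S); case: (v \in S) => /=; ring.
Qed.

(** The inequality holds pair by pair. Subtracting [tau * cover2 G A] pays for pairs joining [A] to
    [Y]; subtracting the sum over [C i] pays for the product term when both ends are in [Y]. *)
Lemma fcover_ge tau A Y (C : 'I_tau -> {set V}) : (0 < tau)%N ->
  [disjoint A & Y] -> Y \subset \bigcup_i C i ->
  tau%:R ^+ 2 * cover2 G A + tau%:R * (2 * \sum_(y in Y) wdeg G y)
    - tau%:R * cover2 G A - \sum_i cover2 G (C i)
  <= fcover (wadj G) tau (fun v => tau%:R * (v \in A)%:R + (v \in Y)%:R).
Proof.
move=> tau0 dAY sY.
rewrite -sum_wadj_in [\sum_i cover2 _ _]exchange_big /= !mulr_sumr.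
rewrite -big_split -!sumrB /=; apply: ler_sum => u _.
rewrite exchange_big /= !mulr_sumr -big_split -!sumrB /=.
apply: ler_sum => v _.
rewrite -mulr_sumr.
set s := \sum_i _; have s0 : 0 <= s by apply: sumr_ge0.
have sY1 : ((u \in Y) && (v \in Y))%:R <= s.
  case: (boolP (u \in Y)) => //= uY; apply: le_trans (_ : 1 <= _).
    by case: (v \in Y).
  have /bigcupP[i _ ui] := subsetP sY u uY.
  by rewrite /s (bigD1 i) //= ui lerDl sumr_ge0.
rewrite !(mulrCA _ (wadj G u v)) -mulrDr -!mulrBr.
apply: ler_wpM2l; first exact: wadj_ge0.
have t1 : 1 <= tau%:R :> R by rewrite ler1n.
have dA x : x \in A -> (x \in Y) = false by apply: disjointFr.
move: sY1; case: (boolP (u \in A)) => [/dA->|_];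
  case: (boolP (v \in A)) => [/dA->|_]; case: (u \in Y); case: (v \in Y);
  rewrite /= ?mulr0 ?mulr1 ?mulr0n ?mulr1n; by move: s0 t1; clear; lra.
Qed.

Lemma kernel_quality tau K : (0 < tau)%N ->
  kernel (fun F => (tau * r F)%N) (wdeg G) setT K ->
  exists S, [/\ S \subset K, indep M S &
    tau%:R * (opt G M - cover_weight G S) <= 2 * opt G M].
Proof.
move=> tau0 kK; have [O [iO cO optO]] := opt_base.
pose A := O :&: K; pose Q := O :\: K.
have OAQ : A :|: Q = O by rewrite setID.
have dAQ : [disjoint A & Q].
  by rewrite -setI_eq0 setIDA setIC setIA -setIDA setDv setI0.
have [|||Y [sY spY cY dY]] := heavy_selection tau0 kK (A := A) (Q := Q).
- by rewrite setSD ?subsetT.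
- by rewrite OAQ.
- exact: dAQ.
have dAY : [disjoint A & Y].
  by rewrite disjoint_sym; move: sY; rewrite subsetD => /andP[].
have [//||C [sAC iC eC]] := @matroid_partition V M tau (fun=> A) Y.
  apply/sparseP => F sF; rewrite !sum_nat_const !card_ord.
  by have /sparseP := spY; apply.
(* The sizes sum to [tau * #|A| + #|Y| = tau * (#|A| + #|Q|) = tau * r setT], so no member can fall
   short of a base. *)
have cC i : #|C i| = r setT.
  have le j : (#|C j| <= r setT)%N by rewrite -(rk_indep (iC j)) rk_mono ?subsetT.
  have eqs : (\sum_j #|C j| = \sum_(j < tau) r setT)%N.
    have -> : (\sum_j #|C j| = \sum_v \sum_j (v \in C j))%N.
      by rewrite exchange_big; apply: eq_bigr => j _; rewrite -sum1_card big_mkcond.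
    under eq_bigr => v _ do rewrite eC sum_nat_const card_ord.
    rewrite big_split -big_distrr /= -!big_mkcond !sum1_card sum_nat_const.
    rewrite card_ord cY -mulnDr -cO -OAQ; congr (_ * _)%N; symmetry.
    by apply/eqP; rewrite (leq_card_setU A Q).2.
  apply/eqP; rewrite eqn_leq le leqNgt; apply/negP => lt.
  have := ltnn (\sum_(j < tau) r setT)%N; rewrite -{1}eqs.
  rewrite (bigD1 i) //= [X in (_ < X)%N](bigD1 i) //= -addSn leq_add //.
  exact: leq_sum.
have sCK i : C i \subset K.
  apply/subsetP => v vC; have := eC v; rewrite (bigD1 i) //= vC sum_nat_const.
  case: (boolP (v \in A)) => [|_]; first by rewrite inE => /andP[].
  rewrite muln0; case: (boolP (v \in Y)) => [/(subsetP sY)|//].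
  by rewrite inE => /andP[].
have [|S [sS iS leS]] := rounding (wadj_sym G) (wadj_ge0 G) (wadj_diag G) tau0
  (B := C) (M := M) (K := K).
  by move=> i; rewrite iC cC sCK.
exists S; split=> //.
have sYC : Y \subset \bigcup_i C i.
  apply/subsetP => v vY; have := eC v; rewrite vY => e.
  apply/bigcupP; apply/exists_inP; apply: contra_eqT e => /exists_inPn H.
  by rewrite big1 ?addn1 // => i _; rewrite (negPf (H i _)).
have eF : fcover (wadj G) tau (fun v => (mult (finfun C) v)%:R) =
    fcover (wadj G) tau (fun v => tau%:R * (v \in A)%:R + (v \in Y)%:R).
  have e v : (mult (finfun C) v)%:R = tau%:R * (v \in A)%:R + (v \in Y)%:R :> R.
    rewrite -natrM -natrD; congr (_%:R); rewrite -[in RHS](card_ord tau).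
    rewrite -sum_nat_const -eC; apply: eq_bigr => i _; by rewrite ffunE.
  by apply: eq_bigr => u _; apply: eq_bigr => v _; rewrite !e.
have lb := fcover_ge tau0 dAY sYC.
rewrite eF fcover_indicator in leS.
(* Each of the two losses in [fcover_ge] is at most [tau * (2 * opt G M)]; divided by [2 * tau],
   together they give the final [2 * opt G M]. *)
have cA : cover2 G A <= 2 * opt G M.
  rewrite -cover_weight2 ler_pM2l // opt_ge //.
  exact: indep_sub (subsetIl _ _) iO.
have cCs : \sum_i cover2 G (C i) <= tau%:R * (2 * opt G M).
  apply: le_trans (_ : \sum_(i < tau) 2 * opt G M <= _).
    by apply: ler_sum => i _; rewrite -cover_weight2 ler_pM2l // opt_ge.
  by rewrite sumr_const card_ord [leRHS]mulr_natl.
have cOQ : cover2 G O <= cover2 G A + 2 * \sum_(q in Q) wdeg G q.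
  rewrite -sum_wadj_in -big_split /=.
  under eq_bigr => u _ do rewrite -big_split /=.
  under eq_bigr => u _ do under eq_bigr => v _ do rewrite -mulrDr.
  apply: cover2_le => u v; rewrite -!natrD ler_nat -OAQ !in_setU.
  by case: (u \in A); case: (v \in A); case: (u \in Q); case: (v \in Q).
have t0 : 0 < tau%:R :> R by rewrite ltr0n.
rewrite -(ler_pM2l t0) -(ler_pM2l (ltr0Sn R 1)).
move: leS lb cA cCs cOQ dY; rewrite -!cover_weight2 expr2.
move: optO t0; move: (\sum_i _) (\sum_(q in Q) _) (\sum_(y in Y) _).
clear => s sq sy optO t0 leS lb cA cCs cOQ dY.
set cS := cover_weight G S in leS *; set t := tau%:R in t0 leS lb cCs dY *.
set cA' := cover_weight G A in lb cA cOQ; set cO' := cover_weight G O in optO cOQ.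
have h1 := ler_wpM2l (ltW t0) cA.
have h2 := ler_wpM2l (ltW t0) dY.
have h3 := ler_wpM2l (ltW t0) (ler_wpM2l (ltW t0) cOQ).
have h4 := ler_wpM2l (ltW t0) (ler_wpM2l (ltW t0) optO).
by move: leS lb cCs h1 h2 h3 h4; clear; lra.
Qed.

End KernelQuality.

(** * The streaming machine and its memory layout *)

Section Machine.
Variables (R : realType) (V : finType).
Local Notation entry := (V * V * R)%type.
Implicit Types (t : seq entry) (mem : seq (cell R V)) (K S : {set V}).
Local Open Scope ring_scope.

(* The memory is a list of triples: [(v, v, x)] records the weighted degree x
   of the stored vertex v and [(v, u, x)], for [u != v], the weight x of the edge vu
   between two stored vertices.  The triple of the vertex being presented comes
   first. *)
Fixpoint parse mem : seq entry :=
  if mem is inl a :: inl b :: inr x :: mem' then (a, b, x) :: parse mem'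
  else [::].

Definition cells t : seq (cell R V) :=
  flatten [seq [:: inl e.1.1; inl e.1.2; inr e.2] | e <- t].

Definition lookup t (k : V * V) : R := \sum_(e <- t | e.1 == k) e.2.

Definition stored t : {set V} := [set v | (v, v) \in [seq e.1 | e <- t]].

(** Inclusion-exclusion for twice the coverage. An edge is recorded only while its later end is
    presented, so both orientations are looked up and the absent one reads 0. *)
Definition estimate t S : R :=
  2 * (\sum_(v in S) lookup t (v, v))
  - \sum_(u in S) \sum_(v in S | v != u) (lookup t (u, v) + lookup t (v, u)).

Lemma parseK t : parse (cells t) = t.
Proof. by elim: t => //= -[[a b] x] t /= ->. Qed.

Lemma size_cells t : size (cells t) = (3 * size t)%N.
Proof. by elim: t => //= e t ->; rewrite mulnS. Qed.

Lemma cells_cons e t :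
  cells (e :: t) = [:: inl e.1.1, inl e.1.2, inr e.2 & cells t].
Proof. by []. Qed.

(** Only an inclusion holds, since [parse] stops at the first malformed triple. *)
Lemma cells_parse_sub mem : {subset cells (parse mem) <= mem}.
Proof.
move: {2}(size mem) (leqnn (size mem)) => n.
elim: n mem => [|n IH] [|[a|x] [|[b|y] [|[c|z] mem]]] //= ltn e.
rewrite -/(cells _) !inE => /or4P[->|->|->|/IH H]; rewrite ?orbT //.
by rewrite H ?orbT //; lia.
Qed.

Lemma mem_cells t c : c \in cells t ->
  exists2 e, e \in t & c \in [:: inl e.1.1; inl e.1.2; inr e.2].
Proof. by move/flattenP => [s /mapP[e et ->]]; exists e. Qed.

Lemma cells_subset t t' : {subset t <= t'} -> {subset cells t <= cells t'}.
Proof.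
move=> sub c /mem_cells[e et ce]; apply/flattenP.
by exists [:: inl e.1.1; inl e.1.2; inr e.2]; rewrite ?map_f ?sub.
Qed.

Variables (tau : nat) (p : pred {set V}).

Definition pruned t :=
  prune (fun F => (tau * rk p F)%N) (fun v => lookup t (v, v)) (stored t).

Definition restrict K t := [seq e <- t | (e.1.1 \in K) && (e.1.2 \in K)].

(** Pruning waits for the next arrival, when the weighted degree of the preceding vertex is
    complete. *)
Definition step t (i : item R V) : seq entry :=
  match i with
  | Arrival v => (v, v, 0) :: restrict (pruned t) t
  | Incidence v u x =>
    if t is e :: t' then
      (e.1, e.2 + x) :: (if u \in stored t' then (v, u, x) :: t' else t')
    else [::]
  end.

Definition kernel_update mem i := cells (step (parse mem) i).

(** The intersection ensures, for every memory and every [p], that only stored vertices are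
    output. *)
Definition kernel_output mem :=
  let t := parse mem in
  stored t :&:
    [arg max_(S > set0 | p S && (S \subset stored t)) estimate t S]%O.

Lemma kernel_update_storable mem i c :
  c \in kernel_update mem i -> storable mem i c.
Proof.
have sub := @cells_parse_sub mem.
case: i => [v|v u x]; rewrite /kernel_update /step.
  rewrite cells_cons !inE => /or4P[/eqP->|/eqP->|/eqP->|].
  - exact: StoreArrival.
  - exact: StoreArrival.
  - exact: StoreZero.
  - move=> H; apply/StoreCopy/sub; apply: cells_subset H => e.
    by rewrite mem_filter => /andP[].
case: (parse mem) sub => [|e t'] //= sub.
have in_t' : c \in cells t' -> storable mem (Incidence v u x) c.
  by move=> H; apply/StoreCopy/sub; rewrite cells_cons !inE H !orbT.
rewrite cells_cons /= !inE => /or4P[/eqP->|/eqP->|/eqP->|].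
- by apply/StoreCopy/sub; rewrite cells_cons !inE eqxx.
- by apply/StoreCopy/sub; rewrite cells_cons !inE eqxx orbT.
- by apply/StoreSum/sub; rewrite cells_cons !inE eqxx !orbT.
case: ifP => // _; rewrite cells_cons !inE => /or4P[/eqP->|/eqP->|/eqP->|//].
- exact: StoreVertex.
- exact: StoreNeighbour.
- exact: StoreWeight.
Qed.

Lemma kernel_output_stored mem v : v \in kernel_output mem -> inl v \in mem.
Proof.
rewrite !inE => /andP[/mapP[[[a b] x] et [-> _]] _].
apply: cells_parse_sub; apply/flattenP.
by exists [:: inl a; inl b; inr x]; rewrite ?inE ?eqxx //; apply/mapP; exists (a, b, x).
Qed.

Definition kernel_machine : stream_machine R V :=
  StreamMachine kernel_update_storable kernel_output_stored.

Lemma run_cells t s : foldl kernel_update (cells t) s = cells (foldl step t s).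
Proof. by elim: s t => //= i s IH t; rewrite /kernel_update parseK IH. Qed.

Lemma run_kernel_machine s : run kernel_machine s = cells (foldl step [::] s).
Proof. exact: (run_cells [::]). Qed.

Lemma stored_restrict K t : K \subset stored t -> stored (restrict K t) = K.
Proof.
move=> /subsetP sK; apply/setP => v; rewrite inE; apply/mapP/idP.
  by move=> [[[a b] x]]; rewrite mem_filter /= => /andP[/andP[aK _] _] [-> _].
move=> vK; have := sK v vK; rewrite inE => /mapP[e et ev].
by exists e => //; rewrite mem_filter -ev /= vK.
Qed.

Lemma lookup_restrict K t k : k.1 \in K -> k.2 \in K ->
  lookup (restrict K t) k = lookup t k.
Proof.
move=> k1 k2; rewrite /lookup big_filter_cond; apply: eq_bigl => e.
by case: eqP => [->|_]; rewrite ?k1 ?k2 ?andbF.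
Qed.

Lemma lookup0 t k : (forall e, e \in t -> e.1 != k) -> lookup t k = 0.
Proof.
by move=> H; rewrite /lookup big_seq_cond big1 // => e /andP[/H/negPf->].
Qed.

Lemma prune_subset (f : {set V} -> nat) (d : V -> R) W : prune f d W \subset W.
Proof.
rewrite /prune; case: ifP => // _; case: pickP => [x _|_]; last exact: sub0set.
exact: subD1set.
Qed.

Lemma size_keys K t : uniq [seq e.1 | e <- t] ->
  (forall e, e \in t -> (e.1.1 \in K) && (e.1.2 \in K)) ->
  (size t <= #|K| ^ 2)%N.
Proof.
move=> un sub; rewrite -(size_map (fun e : entry => e.1)) -(card_uniqP un).
rewrite -mulnn -cardsX; apply/subset_leq_card/subsetP => k /mapP[e et ->].
by rewrite inE sub.
Qed.

Lemma stored_extend v (ext t : seq entry) :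
  (forall e, e \in ext -> e.1.1 = v /\ e.1.2 != v) ->
  stored (ext ++ t) = stored t.
Proof.
move=> H; apply/setP => x; rewrite !inE map_cat mem_cat.
case: mapP => // -[e /H[ev ev'] ex].
by move: ev'; rewrite -ev -ex eqxx.
Qed.

(** Incidences with vertices other than [v] create no diagonal key, so the stored set, and with it
    the test in [step], stays fixed throughout. *)
Lemma foldl_incidences v s t (c : V -> R) (q : seq V) : v \notin q ->
  foldl step ((v, v, s) :: t) [seq Incidence v u (c u) | u <- q] =
  (v, v, s + \sum_(u <- q) c u)
    :: rev [seq (v, u, c u) | u <- q & u \in stored t] ++ t.
Proof.
elim: q s t => [|a q IH] s t; first by rewrite big_nil addr0.
rewrite in_cons negb_or => /andP[va vq] /=.
rewrite big_cons addrA; case: ifP => aS; rewrite IH //=.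
have -> : stored ((v, a, c a) :: t) = stored t.
  apply: (@stored_extend v [:: (v, a, c a)]) => e; rewrite inE => /eqP->.
  by rewrite eq_sym.
by rewrite rev_cons cat_rcons.
Qed.

End Machine.

(** * Stream invariant and correctness of the machine *)

Section Correctness.
Variables (R : realType) (V : finType) (G : wgraph R V) (M : matroid V).
Variable tau : nat.
Local Notation entry := (V * V * R)%type.
Implicit Types (t : seq entry) (K P S : {set V}).
Local Open Scope ring_scope.
Local Notation f := (fun F : {set V} => (tau * rk (indep M) F)%N).
Local Notation N := (tau * mrank M).+1.
Local Notation stepM := (step tau (indep M)).
Local Notation prunedM := (pruned tau (indep M)).

(** This holds between blocks, with [P] the vertices presented so far. The last vertex is still
    unpruned: hence the kernel property speaks of the pruned memory, and [N] allows one extra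
    vertex. *)
Record stream_inv t P : Prop := StreamInv {
  inv_uniq : uniq [seq e.1 | e <- t];
  inv_keys : forall e, e \in t -> (e.1.1 \in stored t) && (e.1.2 \in stored t);
  inv_deg : forall v, v \in stored t -> lookup t (v, v) = wdeg G v;
  inv_adj : forall u v, u \in stored t -> v \in stored t -> u != v ->
    lookup t (u, v) + lookup t (v, u) = wadj G u v;
  inv_kernel : kernel f (wdeg G) P (prunedM t);
  inv_card : (#|stored t| <= N)%N
}.

Lemma f_mono : {homo f : X Y / X \subset Y >-> (X <= Y)%N}.
Proof. by move=> X Y sXY; rewrite leq_mul2l rk_mono ?orbT. Qed.

Lemma f_submodular : submodular f.
Proof. by move=> X Y; rewrite -!mulnDr leq_mul2l rk_submodular orbT. Qed.

Lemma stream_inv0 : stream_inv [::] set0.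
Proof.
have st0 : stored ([::] : seq entry) = set0 by apply/setP => x; rewrite !inE.
split=> // [v|u v||]; rewrite ?st0 ?inE ?cards0 //.
have : prunedM ([::] : seq entry) \subset stored ([::] : seq entry).
  exact: prune_subset.
rewrite st0 subset0 => /eqP->; exact: kernel_set0.
Qed.

Lemma inv_size t P : stream_inv t P -> (size t <= N ^ 2)%N.
Proof.
move=> I; apply: leq_trans (size_keys (inv_uniq I) (inv_keys I)) _.
by rewrite leq_exp2r // (inv_card I).
Qed.

Definition block (v : V) (nb : seq V) : seq (item R V) :=
  Arrival v :: [seq Incidence v u (weight G [set v; u]) | u <- nb].

Lemma wadjE v nb : {in nb, forall u, [set v; u] \in edges G} ->
  [seq Incidence v u (weight G [set v; u]) | u <- nb] =
  [seq Incidence v u (wadj G v u) | u <- nb].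
Proof. by move=> H; apply/eq_in_map => u /H e; rewrite /wadj e. Qed.

Lemma block_state t v nb :
  v \notin nb -> {in nb, forall u, [set v; u] \in edges G} ->
  foldl stepM t (block v nb) =
  (v, v, \sum_(u <- nb) wadj G v u) ::
    rev [seq (v, u, wadj G v u) | u <- nb & u \in prunedM t]
    ++ restrict (prunedM t) t.
Proof.
move=> vnb H; rewrite /block /= (wadjE H) foldl_incidences // add0r.
by rewrite stored_restrict // prune_subset.
Qed.

Section Block.
Variables (t : seq entry) (P : {set V}) (v : V) (nb : seq V).
Hypotheses (I : stream_inv t P) (vP : v \notin P)
  (nbE : perm_eq nb [seq u <- enum V | [set v; u] \in edges G]).

Let K := prunedM t.

Lemma nb_uniq : uniq nb.
Proof. by rewrite (perm_uniq nbE) filter_uniq ?enum_uniq. Qed.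

Lemma mem_nb u : (u \in nb) = ([set v; u] \in edges G).
Proof. by rewrite (perm_mem nbE) mem_filter mem_enum andbT. Qed.

Lemma self_notin_nb : v \notin nb.
Proof.
by rewrite mem_nb; apply/negP => /edges_card2; rewrite setUid cards1.
Qed.

Lemma pruned_subset : K \subset stored t.
Proof. exact: prune_subset. Qed.

Lemma pruned_notin : v \notin K.
Proof.
by apply: contraNN vP; apply/subsetP; have [] := inv_kernel I.
Qed.

Lemma card_pruned : (#|K| <= tau * mrank M)%N.
Proof.
have [_ /sparseP/(_ K (subxx _)) H _] := inv_kernel I.
by apply: leq_trans H _; rewrite leq_mul2l -rk_mrank rk_mono ?orbT ?subsetT.
Qed.

Lemma sum_nb (F : V -> R) : (forall u, u \notin nb -> F u = 0) ->
  \sum_(u <- nb) F u = \sum_u F u.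
Proof.
move=> F0; rewrite big_uniq ?nb_uniq //= big_mkcond; apply: eq_bigr => u _.
by case: ifPn => // /F0.
Qed.

Lemma wadj_nb u : u \notin nb -> wadj G v u = 0.
Proof. by rewrite mem_nb /wadj => /negPf->. Qed.

Let ext (q : seq V) : seq entry :=
  rev [seq (v, u, wadj G v u) | u <- q & u \in K].

Lemma mem_ext q e : e \in ext q ->
  exists u, [/\ u \in q, u \in K & e = (v, u, wadj G v u)].
Proof.
rewrite mem_rev => /mapP[u]; rewrite mem_filter => /andP[uK uq] ->.
by exists u.
Qed.

Lemma lookup_ext u : u \in K -> lookup (ext nb) (v, u) = wadj G v u.
Proof.
move=> uK; rewrite /lookup /ext (perm_big _ (permEl (perm_rev _))) /=.
rewrite big_map big_filter_cond big_mkcond /= sum_nb => [|x xnb]; last first.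
  by rewrite wadj_nb // if_same.
rewrite (bigD1 u) //= uK eqxx big1 ?addr0 // => x xu.
by rewrite xpair_eqE (negPf xu) !andbF.
Qed.

Lemma lookup_ext0 k : k.1 != v -> lookup (ext nb) k = 0.
Proof.
move=> kv; apply: lookup0 => e /mem_ext[u [_ _ ->]] /=.
by apply: contraNneq kv => <-.
Qed.

Lemma lookup_new_row u : lookup (restrict K t) (v, u) = 0.
Proof.
apply: lookup0 => e; rewrite mem_filter => /andP[/andP[e1 _] _].
by apply: contraTneq e1 => ->; exact: pruned_notin.
Qed.

Lemma lookup_new_col u : lookup (restrict K t) (u, v) = 0.
Proof.
apply: lookup0 => e; rewrite mem_filter => /andP[/andP[_ e2] _].
by apply: contraTneq e2 => ->; exact: pruned_notin.
Qed.

Lemma lookup_cons_cat (e : entry) (t1 t2 : seq entry) k :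
  lookup (e :: t1 ++ t2) k =
  (if e.1 == k then e.2 else 0) + (lookup t1 k + lookup t2 k).
Proof.
by rewrite /lookup big_cons big_cat /=; case: ifP; rewrite ?add0r.
Qed.

(** The block of [v] supplies its full degree and its edges to all retained vertices, so
    [kernel_step] applies with the degrees looked up in memory. *)
Lemma block_inv : stream_inv (foldl stepM t (block v nb)) (v |: P).
Proof.
have vK := pruned_notin; have vnb := self_notin_nb.
rewrite block_state // => [|u]; last by rewrite mem_nb.
rewrite -/K -/(ext nb); set s := \sum_(u <- nb) _; set t' := _ :: _.
have es : s = wdeg G v by apply: sum_nb => u; apply: wadj_nb.
have st : stored t' = v |: K.
  have -> : stored t' = v |: stored (ext nb ++ restrict K t).
    apply/setP => x; rewrite /t' !inE /= xpair_eqE andbb.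
    by rewrite eq_sym.
  rewrite (@stored_extend _ _ v) ?stored_restrict ?pruned_subset //.
  move=> e /mem_ext[u [_ uK ->]]; split=> //=.
  by apply: contraNneq vK => <-.
have lk k : lookup t' k = (if (v, v) == k then s else 0)
    + (lookup (ext nb) k + lookup (restrict K t) k) by apply: lookup_cons_cat.
have nev u : u \in K -> u != v by move=> uK; apply: contraNneq vK => <-.
have lkK u w : u \in K -> w \in K -> lookup t' (u, w) = lookup t (u, w).
  move=> uK wK; rewrite lk xpair_eqE eq_sym (negPf (nev u uK)) /=.
  by rewrite lookup_ext0 ?nev // lookup_restrict // !add0r.
have dg x : x \in v |: K -> lookup t' (x, x) = wdeg G x.
  rewrite !inE => /orP[/eqP->|xK].
    rewrite lk eqxx lookup_new_row lookup0 ?addr0 // => e /mem_ext[u [_ uK ->]].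
    by rewrite /= xpair_eqE eqxx nev.
  by rewrite lkK // (inv_deg I) // (subsetP pruned_subset).
have adj1 u : u \in K -> lookup t' (v, u) + lookup t' (u, v) = wadj G v u.
  move=> uK; rewrite !lk !xpair_eqE !eqxx !(eq_sym v) (negPf (nev u uK)) /=.
  rewrite lookup_new_row lookup_new_col lookup_ext // lookup_ext0 ?nev //.
  by rewrite !addr0 add0r.
split.
- have ut : uniq [seq e.1 | e <- restrict K t].
    apply: subseq_uniq (inv_uniq I); exact/map_subseq/filter_subseq.
  have ue : uniq [seq e.1 | e <- ext nb].
    rewrite map_rev rev_uniq -map_comp map_inj_uniq ?filter_uniq ?nb_uniq //.
    by move=> x y [].
  rewrite /t' /= map_cat cat_uniq ut ue mem_cat negb_or andbT /=.
  rewrite -andbA; apply/and3P; split.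
  + apply/mapP => -[e /mem_ext[u [_ uK ->]] /= [vu]].
    by move: (nev u uK); rewrite vu eqxx.
  + apply/mapP => -[e]; rewrite mem_filter => /andP[/andP[e1 _] _] ev.
    by move: vK; rewrite -[v]/((v, v).1) ev e1.
  + apply/hasPn => k /mapP[e]; rewrite mem_filter => /andP[/andP[e1 _] _] ->.
    apply/mapP => -[e' /mem_ext[u [_ uK ->]] /= ee].
    by move: e1; rewrite ee (negPf vK).
- move=> e; rewrite st in_cons mem_cat => /or3P[/eqP->|/mem_ext[u [_ uK ->]]|].
  + by rewrite !inE eqxx.
  + by rewrite !inE eqxx uK orbT.
  + by rewrite mem_filter => /andP[/andP[e1 e2] _]; rewrite !inE e1 e2 !orbT.
- by move=> x; rewrite st; apply: dg.
- move=> x y; rewrite st !in_setU1.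
  move=> /orP[/eqP->|xK] /orP[/eqP->|yK]; rewrite ?eqxx // => xy.
  + exact: adj1.
  + by rewrite addrC wadj_sym; apply: adj1.
  + by rewrite !lkK // (inv_adj I) // (subsetP pruned_subset).
- rewrite /pruned st; apply: kernel_step (inv_kernel I) vP dg.
  + exact: f_mono.
  + exact: f_submodular.
- by rewrite st cardsU1 vK add1n ltnS card_pruned.
Qed.

(** A nonempty prefix of a block is a block with fewer neighbours; it leaves at most
    [1 + #|K| + #|K| ^ 2] triples, within [(#|K| + 1) ^ 2]. *)
Lemma block_peak i : (size (foldl stepM t (take i (block v nb))) <= N ^ 2)%N.
Proof.
case: i => [|i]; first by rewrite take0 /=; apply: inv_size I.
have sub : {subset take i nb <= nb} by apply: mem_take.
have -> : take i.+1 (block v nb) = block v (take i nb).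
  by rewrite /block /= map_take.
rewrite block_state => [||u /sub]; last 2 first.
- by apply: contraNN self_notin_nb; apply: sub.
- by rewrite mem_nb.
rewrite /= size_cat size_rev size_map -/K.
have le1 : (size [seq u <- take i nb | u \in K] <= #|K|)%N.
  rewrite cardE; apply: uniq_leq_size.
    by rewrite filter_uniq // take_uniq // nb_uniq.
  by move=> x; rewrite mem_filter mem_enum => /andP[].
have le2 : (size (restrict K t) <= #|K| ^ 2)%N.
  apply: size_keys => [|e]; last by rewrite mem_filter => /andP[].
  apply: subseq_uniq (inv_uniq I); exact/map_subseq/filter_subseq.
have le3 : (#|K|.+1 ^ 2 <= N ^ 2)%N by rewrite leq_exp2r // ltnS card_pruned.
apply: leq_trans le3; have -> : (#|K|.+1 ^ 2 = #|K| ^ 2 + 2 * #|K| + 1)%N.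
  by clear; rewrite -!mulnn; lia.
by move: le1 le2; clear; lia.
Qed.

End Block.

Lemma blocks_inv (order : seq V) (nbr : V -> seq V) t P :
  stream_inv t P -> uniq order -> {in order, forall v, v \notin P} ->
  (forall v, perm_eq (nbr v) [seq u <- enum V | [set v; u] \in edges G]) ->
  let s := flatten [seq block v (nbr v) | v <- order] in
  stream_inv (foldl stepM t s) ([set v in order] :|: P) /\
  forall i, (size (foldl stepM t (take i s)) <= N ^ 2)%N.
Proof.
move=> I un dP nbE; elim: order t P I un dP => [|v order IH] t P I /= un dP.
  have -> : [set v in [::]] :|: P = P by apply/setP => x; rewrite !inE.
  by split=> // i; apply: inv_size I.
case/andP: un => vo un.
have vP : v \notin P by apply: dP; rewrite mem_head.
have dP' : {in order, forall x, x \notin v |: P}.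
  move=> x xo; rewrite !inE negb_or dP ?inE ?xo ?orbT // andbT.
  by apply: contraNneq vo => <-.
have [I' peak] := IH _ _ (block_inv I vP (nbE v)) un dP'.
rewrite foldl_cat; split.
  suff -> : [set x in v :: order] :|: P = [set x in order] :|: (v |: P) by [].
  by apply/setP => x; rewrite !inE -orbA orbCA.
move=> i; rewrite -cat_cons -/(block v (nbr v)) take_cat.
case: ltnP => _; first exact: (block_peak I (nbE v)).
by rewrite foldl_cat; apply: peak.
Qed.

Lemma estimate_cover t P S : stream_inv t P -> S \subset stored t ->
  estimate t S = 2 * cover_weight G S.
Proof.
move=> I /subsetP sS; rewrite cover_weight2 /estimate.
have -> : \sum_(v in S) lookup t (v, v) = \sum_(v in S) wdeg G v.
  by apply: eq_bigr => v /sS; apply: (inv_deg I).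
rewrite -sum_wadj_in /cover2 [X in _ - X](_ : _ =
    \sum_u \sum_v wadj G u v * ((u \in S) && (v \in S))%:R).
  rewrite -sumrB; apply: eq_bigr => u _; rewrite -sumrB.
  apply: eq_bigr => v _; rewrite -mulrBr; congr (_ * _).
  by case: (u \in S); case: (v \in S); rewrite /=; ring.
rewrite big_mkcond; apply: eq_bigr => u _.
case: (boolP (u \in S)) => uS; last by rewrite big1 // => v _; rewrite mulr0.
rewrite big_mkcond; apply: eq_bigr => v _ /=.
case: (boolP (v \in S)) => [vS|]; last by rewrite mulr0.
case: eqVneq => [->|vu] /=; first by rewrite wadj_diag mul0r.
by rewrite mulr1 (inv_adj I) ?sS // eq_sym.
Qed.

Lemma stream_final (order : seq V) (nbr : V -> seq V) :
  perm_eq order (enum V) ->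
  (forall v, perm_eq (nbr v) [seq u <- enum V | [set v; u] \in edges G]) ->
  let s := flatten [seq block v (nbr v) | v <- order] in
  stream_inv (foldl stepM [::] s) setT /\
  forall i, (size (foldl stepM [::] (take i s)) <= N ^ 2)%N.
Proof.
move=> ord nbE.
have un : uniq order by rewrite (perm_uniq ord) enum_uniq.
have := blocks_inv stream_inv0 un _ nbE; rewrite setU0.
have -> : [set v in order] = setT.
  by apply/setP => v; rewrite !inE (perm_mem ord) mem_enum.
by apply => v _; rewrite inE.
Qed.

(** [kernel_quality] provides a good set inside the pruned kernel; the output maximises the exact
    coverage over the larger [stored t], so it is at least as good. Each triple takes three
    variables. *)
Lemma kernel_machine_correct s : (0 < tau)%N -> incidence_stream G s ->
  let m := kernel_machine R tau (indep M) in
  let S := output m (run m s) in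
  [/\ indep M S, tau%:R * (opt G M - cover_weight G S) <= 2 * opt G M
    & (peak_memory m s <= 3 * N ^ 2)%N].
Proof.
move=> tau0 [order [nbr [ord nbE es]]] m S.
have [I peak] := stream_final ord nbE; rewrite -es in I peak.
have {}peak : (peak_memory m s <= 3 * N ^ 2)%N.
  apply/bigmax_leqP => i _.
  by rewrite run_kernel_machine size_cells leq_mul2l peak.
have [S0 [sS0 iS0 qS0]] := kernel_quality tau0 (inv_kernel I).
move: @S; rewrite /m run_kernel_machine /= /kernel_output parseK.
set t := foldl stepM _ s in I sS0 *.
case: arg_maxP => [|S1 /andP[iS1 sS1] max1]; first by rewrite indep0 sub0set.
rewrite (setIidPr sS1); split=> //.
have sS0t : S0 \subset stored t by apply: subset_trans sS0 (prune_subset _ _ _).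
have : estimate t S0 <= estimate t S1 by apply: max1; rewrite iS0 sS0t.
rewrite !(estimate_cover I) // ler_pM2l // => le.
apply: le_trans qS0; rewrite ler_pM2l ?ltr0n // lerB //.
Qed.

End Correctness.

(** * Choice of [tau] and the constant in the memory bound *)

Section Algorithm.
Variable R : realType.
Local Open Scope ring_scope.

Definition idle_machine (V : finType) : stream_machine R V.
Proof.
by refine (@StreamMachine R V (fun _ _ => [::]) (fun=> set0) _ _) => [//|mem v];
  rewrite inE.
Defined.

Lemma run_idle (V : finType) s : run (idle_machine V) s = [::].
Proof. by rewrite /run; elim/last_ind: s => // s i _; rewrite foldl_rcons. Qed.

(* For [eps >= 1] the empty set is good enough, and no memory may be used when
   [k / eps] is small. *)
Definition matroid_cover_algorithm (eps : R) : stream_algorithm R :=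
  fun V p =>
    if (1 <= eps) || (rk p setT == 0)%N then idle_machine V
    else kernel_machine R (Num.truncn (2 / eps)).+1 p.

Lemma opt_ge0 (V : finType) (G : wgraph R V) (M : matroid V) : 0 <= opt G M.
Proof.
apply: le_trans (opt_ge G (indep0 M)); apply: sumr_ge0 => e /andP[eG _].
exact: weight_ge0.
Qed.

Lemma matroid_cover_extracts (eps : R) (V : finType) (G : wgraph R V)
    (M : matroid V) : 0 < eps ->
  extracts (matroid_cover_algorithm eps) eps G M
    (48 * ((mrank M)%:R / eps) ^+ 2).
Proof.
move=> e0 s Hs; rewrite /matroid_cover_algorithm rk_mrank.
have opt0 := opt_ge0 G M.
case: ifPn => [idle|]; rewrite /=.
  have -> : peak_memory (idle_machine V) s = 0%N.
    by apply/eqP; rewrite -leqn0; apply/bigmax_leqP => i _; rewrite run_idle.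
  split; [exact: indep0 | | by rewrite mulr_ge0 // sqr_ge0].
  have c0 : 0 <= cover_weight G set0.
    by apply: sumr_ge0 => e /andP[eG _]; apply: weight_ge0.
  case/orP: idle => [e1|/eqP k0].
    by apply: le_trans c0; rewrite mulr_le0_ge0 // subr_le0.
  (* In rank 0 the optimal base is empty. *)
  have [O [_ cO leO]] := opt_base G M.
  rewrite rk_mrank k0 in cO; rewrite (cards0_eq cO) in leO.
  by apply: le_trans leO; rewrite ler_piMl // lerBlDr lerDl ltW.
rewrite negb_or -ltNge -lt0n => /andP[e1 k0].
set tau := (Num.truncn _).+1.
have [iS qS peak] := @kernel_machine_correct R V G M tau s isT Hs.
split=> //.
  set S := output _ _ in qS *.
  (* This bounds the relative loss [2 / tau] by [eps]. *)
  have te : 2 < tau%:R * eps by rewrite -ltr_pdivrMr // truncnS_gt.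
  rewrite leNgt; apply/negP => lt.
  have t0 : 0 < tau%:R :> R by rewrite ltr0n.
  have : tau%:R * (eps * opt G M) < tau%:R * (opt G M - cover_weight G S).
    by rewrite ltr_pM2l //; move: lt; clear; lra.
  have : 2 * opt G M <= tau%:R * eps * opt G M by rewrite ler_wpM2r // ltW.
  by move: qS; clear; rewrite -mulrA; lra.
have peak' : (peak_memory (kernel_machine R tau (indep M)) s)%:R
    <= 3 * ((tau * mrank M)%:R + 1) ^+ 2 :> R.
  by rewrite natr1 -natrX -natrM ler_nat.
apply: le_trans peak' _.
(* With [k] the rank, [eps < 1] and [1 <= k] give [1 <= k <= x], hence
   [tau * k + 1 <= 2 * x + k + 1 <= 4 * x]; three variables per triple make the constant
   [3 * 4 ^ 2 = 48]. *)
set x := (mrank M)%:R / eps.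
have k1 : 1 <= (mrank M)%:R :> R by rewrite ler1n.
have kx : (mrank M)%:R <= x by rewrite ler_pdivlMr // ler_piMr ?ltW // (lt_le_trans ltr01).
have tx : (tau * mrank M)%:R <= 2 * x + (mrank M)%:R.
  have -> : 2 * x + (mrank M)%:R = (2 / eps + 1) * (mrank M)%:R.
    by rewrite /x; ring.
  rewrite natrM ler_wpM2r // /tau -natr1 lerD2r truncn_le //.
  by rewrite divr_ge0 // ltW.
have -> : 48 * x ^+ 2 = 3 * (4 * x) ^+ 2 by ring.
rewrite ler_wpM2l // ler_pXn2r ?nnegrE //.
- by move: tx kx k1; clear; lra.
- by rewrite addr_ge0.
- by rewrite mulr_ge0 // (le_trans ler01) // (le_trans k1).
Qed.

End Algorithm.

Local Open Scope ring_scope.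

Theorem theorem6 (R : realType) :
  (exists C : R, forall eps : R, 0 < eps ->
     exists A : stream_algorithm R,
       forall (V : finType) (G : wgraph R V) (M : matroid V) (k : nat),
         mrank M = k ->
         [\/ uniform_matroid M, partition_matroid M | laminar_matroid M] ->
         extracts A eps G M (C * (k%:R / eps) ^+ 2))
  /\
  (exists C : R, forall eps : R, 0 < eps ->
     exists A : stream_algorithm R,
       forall (V : finType) (G : wgraph R V) (M : matroid V) (k : nat),
         mrank M = k ->
         transversal_matroid M ->
         extracts A eps G M (C * (k%:R / eps + k%:R) ^+ 2)).
Proof.
split; exists 48 => eps e0; exists (matroid_cover_algorithm eps) => V G M k <- _.
  exact: matroid_cover_extracts.
move=> s Hs; have [iS qS peak] := matroid_cover_extracts M e0 Hs.
split=> //; apply: le_trans peak _.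
have x0 : 0 <= (mrank M)%:R / eps by rewrite divr_ge0 // ltW.
by rewrite ler_wpM2l // ler_pXn2r ?nnegrE ?addr_ge0 // lerDl.
Qed.
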